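(* Let $H_1,H_2$ be graphs neither of which is (isomorphic to) an induced subgraph of $P_4$. Then, up to interchanging the roles of $H_1$ and $H_2$, the following hold. (a) The family of $(H_1,H_2)$-free graphs is near optimal colourable only if $H_1$ is a forest and $H_2\in\mathcal{X}$ (that is: if the family is near optimal colourable, then one of the two graphs is a forest and the other belongs to $\mathcal{X}$). (b) Moreover, if $H_2\in\mathcal{X}'$, then the family of $(H_1,H_2)$-free graphs is near optimal colourable if and only if $H_1=2K_2$. Here membership and equality are understood up to isomorphism, $\mathcal{X}$ is the set consisting of the graphs (1) $P_4\vee K_n$ for $n\geq 1$, (2) $(K_2+K_1)\vee K_n$ for $n\geq 1$, (3) $K_n-e$ for $n\geq 4$, (4) $K_n$ for $n\geq 3$, and $\mathcal{X}'$ is the set consisting of all graphs in (1) and (2) except the paw $(K_2+K_1)\vee K_1$; that is, $\mathcal{X}'=\{P_4\vee K_n : n\geq 1\}\cup\{(K_2+K_1)\vee K_n : n\geq 2\}$.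
   Context: All graphs are finite and simple. $P_n$ and $K_n$ denote the path and the complete graph on $n$ vertices. $G+H$ is the disjoint union of vertex-disjoint graphs $G$ and $H$, and $rG$ is the disjoint union of $r$ copies of $G$. $G\vee H$ is obtained from $G+H$ by adding an edge between every vertex of $G$ and every vertex of $H$. $K_n-e$ is $K_n$ with one edge removed. A forest is an acyclic graph. A graph $G$ contains $H$ if $G$ has an induced subgraph isomorphic to $H$; $G$ is $H$-free if it does not contain $H$, and $(H_1,H_2)$-free if it is both $H_1$-free and $H_2$-free. $\chi(G)$ is the chromatic number and $\omega(G)$ the clique number of $G$. A graph family $\mathcal{G}$ is near optimal colourable if there is a constant number $c$ such that every $G\in\mathcal{G}$ satisfies $\chi(G)\leq\max\{c,\omega(G)\}$. *)

(* Defs.v *)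
From mathcomp Require Import all_boot.

Set Implicit Arguments.
Unset Strict Implicit.
Unset Printing Implicit Defensive.

Record sgraph := SGraph {
  vertex :> finType;
  adj : rel vertex;
  adj_sym : symmetric adj;
  adj_irrefl : irreflexive adj }.

Notation "x -- y" := (adj x y) (at level 30).

Definition iso (G H : sgraph) : Prop :=
  exists2 f : G -> H, bijective f & {mono f : x y / x -- y}.

Notation "G ≃ H" := (iso G H) (at level 70).

Section Constructions.
Variables (G H : sgraph).

Definition induced_adj (A : {set G}) : rel {x : G | x \in A} :=
  relpre val (@adj G).

Lemma induced_adj_sym A : symmetric (@induced_adj A).
Proof. by move=> x y; apply: adj_sym. Qed.

Lemma induced_adj_irrefl A : irreflexive (@induced_adj A).
Proof. by move=> x; apply: adj_irrefl. Qed.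

Definition induced (A : {set G}) : sgraph :=
  SGraph (@induced_adj_sym A) (@induced_adj_irrefl A).

Definition union_adj : rel (G + H) := fun u v =>
  match u, v with
  | inl x, inl y => x -- y
  | inr x, inr y => x -- y
  | _, _ => false
  end.

Lemma union_adj_sym : symmetric union_adj.
Proof. by case=> x [] y //=; apply: adj_sym. Qed.

Lemma union_adj_irrefl : irreflexive union_adj.
Proof. by case=> x /=; apply: adj_irrefl. Qed.

Definition gunion : sgraph := SGraph union_adj_sym union_adj_irrefl.

Definition join_adj : rel (G + H) := fun u v =>
  match u, v with
  | inl x, inl y => x -- y
  | inr x, inr y => x -- y
  | _, _ => true
  end.

Lemma join_adj_sym : symmetric join_adj.
Proof. by case=> x [] y //=; apply: adj_sym. Qed.

Lemma join_adj_irrefl : irreflexive join_adj.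
Proof. by case=> x /=; apply: adj_irrefl. Qed.

Definition gjoin : sgraph := SGraph join_adj_sym join_adj_irrefl.

Variable r : nat.

Definition copies_adj : rel ('I_r * G) := fun u v =>
  (u.1 == v.1) && u.2 -- v.2.

Lemma copies_adj_sym : symmetric copies_adj.
Proof. by move=> u v; rewrite /copies_adj eq_sym adj_sym. Qed.

Lemma copies_adj_irrefl : irreflexive copies_adj.
Proof. by move=> u; rewrite /copies_adj adj_irrefl andbF. Qed.

Definition copies : sgraph := SGraph copies_adj_sym copies_adj_irrefl.

Variables a b : G.

Definition del_edge_adj : rel G := fun x y =>
  x -- y && ([set x; y] != [set a; b]).

Lemma del_edge_adj_sym : symmetric del_edge_adj.
Proof. by move=> x y; rewrite /del_edge_adj adj_sym setUC. Qed.

Lemma del_edge_adj_irrefl : irreflexive del_edge_adj.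
Proof. by move=> x; rewrite /del_edge_adj adj_irrefl. Qed.

Definition del_edge : sgraph := SGraph del_edge_adj_sym del_edge_adj_irrefl.

End Constructions.

Section PathComplete.
Variable n : nat.

Definition path_adj : rel 'I_n := fun i j => (i.+1 == j) || (j.+1 == i).

Lemma path_adj_sym : symmetric path_adj.
Proof. by move=> i j; rewrite /path_adj orbC. Qed.

Lemma path_adj_irrefl : irreflexive path_adj.
Proof. by move=> i; rewrite /path_adj orbb eqn_leq ltnn. Qed.

Definition pathG : sgraph := SGraph path_adj_sym path_adj_irrefl.

Definition complete_adj : rel 'I_n := fun i j => i != j.

Lemma complete_adj_sym : symmetric complete_adj.
Proof. by move=> i j; rewrite /complete_adj eq_sym. Qed.

Lemma complete_adj_irrefl : irreflexive complete_adj.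
Proof. by move=> i; rewrite /complete_adj eqxx. Qed.

Definition completeG : sgraph := SGraph complete_adj_sym complete_adj_irrefl.

End PathComplete.

Notation "'P_ n" := (pathG n) (at level 8, n at level 2, format "''P_' n").
Notation "'K_ n" := (completeG n) (at level 8, n at level 2, format "''K_' n").
Notation "G ⊕ H" := (gunion G H) (at level 50, left associativity).
Notation "G ∨ H" := (gjoin G H) (at level 50, left associativity).

Definition contains (G H : sgraph) : Prop :=
  exists A : {set G}, induced A ≃ H.

Definition free2 (H1 H2 G : sgraph) : Prop :=
  ~ contains G H1 /\ ~ contains G H2.

(* [ucycle] also accepts the sequences [:: x; y] running back and forth along
   an edge; a graph cycle has at least three vertices. *)
Definition forest (G : sgraph) : Prop :=
  forall s : seq G, ucycle (@adj G) s -> size s < 3.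

Definition clique (G : sgraph) (A : {set G}) : bool :=
  [forall x in A, forall y in A, (x != y) ==> x -- y].

Definition omega (G : sgraph) : nat := \max_(A : {set G} | clique A) #|A|.

Definition colourable (G : sgraph) (k : nat) : bool :=
  [exists f : {ffun G -> 'I_k}, forall x, forall y, x -- y ==> (f x != f y)].

Lemma colourable_ex (G : sgraph) : exists k, colourable G k.
Proof.
exists #|G|; apply/existsP; exists [ffun x => enum_rank x].
apply/forallP=> x; apply/forallP=> y; apply/implyP=> xy; rewrite !ffunE.
by apply: contraTneq xy => /enum_rank_inj->; rewrite adj_irrefl.
Qed.

Definition chi (G : sgraph) : nat := ex_minn (colourable_ex G).

Definition near_optimal_colourable (F : sgraph -> Prop) : Prop :=
  exists c : nat, forall G, F G -> chi G <= maxn c (omega G).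

(* Graphs are only considered up to isomorphism, so sets of graphs are
   isomorphism-closed predicates. *)
Definition classX (H : sgraph) : Prop :=
  [\/ exists2 n, 1 <= n & H ≃ 'P_4 ∨ 'K_n,
      exists2 n, 1 <= n & H ≃ ('K_2 ⊕ 'K_1) ∨ 'K_n,
      exists2 n, 4 <= n & exists a b : 'K_n, a -- b /\ H ≃ del_edge a b
    | exists2 n, 3 <= n & H ≃ 'K_n].

Definition classX' (H : sgraph) : Prop :=
  (exists2 n, 1 <= n & H ≃ 'P_4 ∨ 'K_n) \/
  (exists2 n, 2 <= n & H ≃ ('K_2 ⊕ 'K_1) ∨ 'K_n).

(* Main.v *)
Require Import Defs.
From mathcomp Require Import all_boot.
From mathcomp Require Import zify.

Set Implicit Arguments.
Unset Strict Implicit.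
Unset Printing Implicit Defensive.

(** If the family of (H1,H2)-free graphs is near optimal colourable with constant [c], every
    graph whose chromatic number exceeds both [c] and its clique number contains
    [H1] or [H2]. Part (a) and one direction of (b) follow from applying this to three
    kinds of graphs.

    - Graphs of large girth and large chromatic number ([large_girth_large_chi], by
      counting functions that encode sparse random graphs). Hence one of the two graphs, say
      [H1], is a forest.
    - The joins of [K_c] with [C_5] and with the complement of [C_7]
      ([join_escapes_bound]). They have no three pairwise non-adjacent vertices and no
      [2K_2], whereas a forest that is not contained in [P_4] has one or the other
      ([no_triple_forest_2K2]). Hence both joins contain [H2]. Since [C_5] is not
      contained in the complement of [C_7], the copy of [H2] in the join with [C_5]
      misses a vertex of [C_5], so [H2] is contained in [P_4 ∨ K_c]. The graphs contained
      in such joins but not in [P_4] are exactly those in X ([P4_join_classX]).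
    - The blow-up of [C_5] that replaces two non-adjacent vertices by cliques of the same
      large size. It contains no graph of X' and no three pairwise non-adjacent
      vertices, so for [H2] in X' it contains [H1], and the forest [H1] must be [2K_2].

    For the other direction of (b), every graph in X' is contained in some
    [P_4 ∨ K_n], so it suffices to colour a graph without [2K_2] and [P_4 ∨ K_n] whose
    clique number is large with as many colours as a maximum clique [K] has vertices
    ([colourable_clique]); for bounded clique number, forbidding [2K_2] alone bounds
    the chromatic number ([colourable_sqr]). The vertices that miss exactly one
    vertex of [K] form independent columns, pairwise complete to each other, and the column
    of [a] gets colour [a]. Another vertex [v] may use the colours of the columns where
    it has no neighbour; there is at least one, as otherwise [K] could be enlarged.
    Forbidding [P_4 ∨ K_n] makes these lists of free colours behave like a family
    of nearly cross-free sets: adjacent vertices share at most one free colour, and only if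
    their lists are nearly complementary, while lists of non-adjacent vertices are nested
    or nearly cover [K]. [conflict_free_choice] picks a proper colouring from such lists. *)

(** * Embeddings, colourings and cliques *)

(** A map-based form of containment, closed under composition and independent of
    the choice of a vertex set in the host. *)
Definition embeds (H G : sgraph) : Prop :=
  exists2 f : H -> G, injective f & {mono f : x y / x -- y}.

Lemma containsP (G H : sgraph) : contains G H <-> embeds H G.
Proof.
split=> [[A [f [g fK gK] fM]]|[f f_inj fM]].
  exists (fun x => val (g x)) => [x y /val_inj/(can_inj gK)//|x y].
  by rewrite -{2}(gK x) -{2}(gK y) fM.
pose A := [set f x | x in H].
have fA x : f x \in A by apply: imset_f.
have Af (u : induced A) : exists x, f x == val u.
  by case: u => u /= /imsetP[x _ ->]; exists x.
exists A; exists (fun u => xchoose (Af u)).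
  exists (fun x => Sub (f x) (fA x)) => [u|x].
    by apply: val_inj => /=; apply/eqP; apply: (xchooseP (Af u)).
  by apply: f_inj; apply/eqP/(xchooseP (Af (Sub (f x) (fA x)))).
move=> u v; rewrite -fM (eqP (xchooseP (Af u))) (eqP (xchooseP (Af v))).
by [].
Qed.

(** Embeddings form a finite set, so the case distinctions on them below are
    constructive. *)
Lemma embedsP (H G : sgraph) :
  reflect (embeds H G) [exists f : {ffun H -> G}, injectiveb f &&
    [forall x, forall y, (f x -- f y) == (x -- y)]].
Proof.
apply: (iffP existsP) => [[f /andP[/injectiveP fI /forallP fM]]|[f fI fM]].
  by exists f => // x y; apply/eqP/(forallP (fM x)).
exists (finfun f); apply/andP; split.
  by apply/injectiveP=> x y; rewrite !ffunE; apply: fI.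
by apply/forallP=> x; apply/forallP=> y; rewrite !ffunE fM.
Qed.

Lemma embeds_trans (H G K : sgraph) : embeds H G -> embeds G K -> embeds H K.
Proof.
move=> [f fI fM] [g gI gM]; exists (g \o f); first exact: inj_comp.
by move=> x y /=; rewrite gM fM.
Qed.

Lemma iso_embeds (G H : sgraph) : G ≃ H -> embeds G H.
Proof. by move=> [f /bij_inj fI fM]; exists f. Qed.

Lemma iso_sym (G H : sgraph) : G ≃ H -> H ≃ G.
Proof.
move=> [f [g fK gK] fM]; exists g; first by exists f.
by move=> x y; rewrite -fM !gK.
Qed.

Lemma embeds_card_iso (G H : sgraph) : embeds G H -> #|H| <= #|G| -> G ≃ H.
Proof. by move=> [f fI fM] le; exists f => //; apply: inj_card_bij. Qed.

Lemma adj_neq (G : sgraph) (x y : G) : x -- y -> x != y.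
Proof. by apply: contraTneq => ->; rewrite adj_irrefl. Qed.

Lemma colourableP (G : sgraph) k :
  reflect (exists f : G -> 'I_k, forall x y, x -- y -> f x != f y)
          (colourable G k).
Proof.
apply: (iffP existsP) => [[f /forallP fP]|[f fP]].
  by exists f => x y; apply/implyP/(forallP (fP x)).
exists (finfun f); apply/forallP=> x; apply/forallP=> y; apply/implyP.
by rewrite !ffunE; apply: fP.
Qed.

Lemma colourable_card (G : sgraph) (T : finType) (f : G -> T) k :
  (forall x y, x -- y -> f x != f y) -> #|T| <= k -> colourable G k.
Proof.
move=> fP le; apply/colourableP.
exists (fun x => widen_ord le (enum_rank (f x))) => x y /fP.
by apply: contraNneq => /(congr1 val) /= /ord_inj/enum_rank_inj->.
Qed.

Lemma colourable_set (G : sgraph) (T : finType) (A : {set T}) (f : G -> T) :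
  (forall v, f v \in A) -> (forall v w, v -- w -> f v != f w) ->
  colourable G #|A|.
Proof.
move=> fA fP; pose g v : {x | x \in A} := Sub (f v) (fA v).
apply: (@colourable_card _ _ g); first by move=> v w; rewrite -val_eqE; apply: fP.
by rewrite card_sig; apply/subset_leq_card/subsetP.
Qed.

Lemma chi_colourable (G : sgraph) : colourable G (chi G).
Proof. by rewrite /chi; case: ex_minnP. Qed.

Lemma chi_leq (G : sgraph) k : (chi G <= k) = colourable G k.
Proof.
apply/idP/idP=> [le|col]; last by rewrite /chi; case: ex_minnP => n _; apply.
have /colourableP[f fP] := chi_colourable G.
by apply: (colourable_card fP); rewrite card_ord.
Qed.

Lemma cliqueP (G : sgraph) (A : {set G}) :
  reflect {in A &, forall x y, x != y -> x -- y} (clique A).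
Proof.
apply: (iffP forall_inP) => [cA x y xA yA|cA x xA].
  by apply/implyP/(forall_inP (cA x xA)).
by apply/forall_inP=> y yA; apply/implyP/cA.
Qed.

Lemma clique_omega (G : sgraph) (A : {set G}) : clique A -> #|A| <= omega G.
Proof. by move=> cA; rewrite /omega (bigD1 A) //= leq_maxl. Qed.

Lemma omega_leq (G : sgraph) k :
  (forall A : {set G}, clique A -> #|A| <= k) -> omega G <= k.
Proof. by move=> h; apply/bigmax_leqP. Qed.

Lemma clique0 (G : sgraph) : clique (set0 : {set G}).
Proof. by apply/cliqueP => x y; rewrite inE. Qed.

Lemma max_clique (G : sgraph) : exists2 K : {set G}, clique K & #|K| = omega G.
Proof.
have := @eq_bigmax_cond _ [pred A : {set G} | clique A] (fun A => #|A|).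
case=> [|K /= cK eqK]; first by apply/card_gt0P; exists set0; apply: clique0.
by exists K.
Qed.

Lemma clique_adj (G : sgraph) (A : {set G}) x y :
  clique A -> x \in A -> y \in A -> x != y -> x -- y.
Proof. by move=> /cliqueP cA xA yA; apply: cA. Qed.

Lemma clique_add (G : sgraph) (A : {set G}) x :
  clique A -> {in A, forall y, x -- y} -> clique (x |: A).
Proof.
move=> cA xA; apply/cliqueP=> u v /setU1P[->|uA] /setU1P[->|vA] uv.
- by rewrite eqxx in uv.
- exact: xA.
- by rewrite adj_sym; apply: xA.
- exact: clique_adj cA uA vA uv.
Qed.

Lemma ord2_cases (i : 'I_2) : i = ord0 \/ i = ord_max.
Proof. by case: i => [[|[|]]] // lt; [left|right]; apply: val_inj. Qed.

(** A map that preserves and reflects adjacency can only identify vertices with the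
    same neighbourhood. *)
Lemma embeds_twinfree (H G : sgraph) (f : H -> G) :
    (forall u v : H, (forall w, u -- w = v -- w) -> u = v) ->
  {mono f : x y / x -- y} -> embeds H G.
Proof.
by move=> tw fM; exists f => // u v fuv; apply: tw => w; rewrite -!fM fuv.
Qed.

Lemma embeds_2K2 (G : sgraph) (a b c d : G) :
    a -- b -> c -- d -> ~~ (a -- c) -> ~~ (a -- d) -> ~~ (b -- c) -> ~~ (b -- d) ->
  embeds (copies 'K_2 2) G.
Proof.
move=> ab cd ac ad bc bd.
pose f (u : copies 'K_2 2) := if u.1 == ord0 then (if u.2 == ord0 then a else b)
                              else (if u.2 == ord0 then c else d).
have sym := adj_sym; have irr := adj_irrefl.
apply: (@embeds_twinfree _ _ f).
  move=> [i j] [i' j'] /(_ (i, if j == ord0 then ord_max else ord0)) /=.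
  rewrite /copies_adj /complete_adj /= eqxx.
  by case: (ord2_cases i) (ord2_cases j) (ord2_cases i') (ord2_cases j')
    => -> [] -> [] -> [] ->.
move=> [i j] [i' j']; rewrite /f /=.
case: (ord2_cases i) (ord2_cases j) (ord2_cases i') (ord2_cases j')
  => -> [] -> [] -> [] -> //=;
  rewrite ?irr ?ab ?cd // ?[b -- a]sym ?[d -- c]sym ?ab ?cd //;
  rewrite ?[c -- _]sym ?[d -- _]sym; exact: negbTE.
Qed.

Definition p4_map (T : Type) (w x y z : T) (i : 'I_4) : T := nth z [:: w; x; y] i.

Lemma p4_map_mono (G : sgraph) (w x y z : G) :
    w -- x -> x -- y -> y -- z -> ~~ (w -- y) -> ~~ (w -- z) -> ~~ (x -- z) ->
  forall i j : 'P_4, p4_map w x y z i -- p4_map w x y z j = i -- j.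
Proof.
move=> wx xy yz wy wz xz [[|[|[|[|i]]]] i4] [[|[|[|[|j]]]] j4] //=;
  rewrite /path_adj /= ?adj_irrefl ?wx ?xy ?yz //;
  rewrite ?[y -- w]adj_sym ?[z -- w]adj_sym ?[z -- x]adj_sym; try exact: negbTE;
  by rewrite adj_sym.
Qed.

Lemma P4_twinfree (i j : 'P_4) : (forall k, i -- k = j -- k) -> i = j.
Proof.
case: i j => [[|[|[|[|i]]]] i4] // [[|[|[|[|j]]]] j4] //= h; apply: val_inj => //=;
 by have := h (@Ordinal 4 0 isT); have := h (@Ordinal 4 1 isT);
   have := h (@Ordinal 4 2 isT); have := h (@Ordinal 4 3 isT).
Qed.

(** How every copy of [P_4 ∨ K_n] is produced below. The adjacencies already force
    the vertices to be distinct, because the join has no twins. *)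
Lemma embeds_P4_join (G : sgraph) (w x y z : G) (Q : {set G}) n :
    w -- x -> x -- y -> y -- z -> ~~ (w -- y) -> ~~ (w -- z) -> ~~ (x -- z) ->
    clique Q -> n <= #|Q| ->
    {in Q, forall q, [&& q -- w, q -- x, q -- y & q -- z]} ->
  embeds ('P_4 ∨ 'K_n) G.
Proof.
move=> wx xy yz wy wz xz cQ nQ Qadj.
pose k (j : 'I_n) : G := enum_val (widen_ord nQ j).
have kQ j : k j \in Q by apply: enum_valP.
have kM (i j : 'K_n) : k i -- k j = i -- j.
  have [->|ij] := eqVneq i j; first by rewrite !adj_irrefl.
  rewrite /= /complete_adj ij; apply: (clique_adj cQ) => //.
  by apply: contraNneq ij => /enum_val_inj/(congr1 val)/= ?; apply/eqP/val_inj.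
have pk i j : k j -- p4_map w x y z i.
  by have /and4P[] := Qadj _ (kQ j); case: i => [[|[|[|[|]]]]].
pose f (u : 'P_4 ∨ 'K_n) := match u with inl i => p4_map w x y z i | inr j => k j end.
have pM := p4_map_mono wx xy yz wy wz xz.
have fM : {mono f : u v / u -- v}.
  by move=> [i|i] [j|j] /=; rewrite ?pM ?kM // ?[p4_map _ _ _ _ _ -- _]adj_sym pk.
apply: (embeds_twinfree _ fM) => -[i|i] [j|j] h.
- by congr inl; apply: P4_twinfree => l; apply: (h (inl l)).
- by have := h (inr j); rewrite /= /complete_adj eqxx.
- by have := h (inr i); rewrite /= /complete_adj eqxx.
- by have := h (inr j); rewrite /= /complete_adj eqxx => /negbFE/eqP->.
Qed.

Lemma embeds_complete n (G : sgraph) (g : 'I_n -> G) :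
  (forall i j, i != j -> g i -- g j) -> embeds 'K_n G.
Proof.
move=> gP; have gM : {mono (g : 'K_n -> G) : i j / i -- j}.
  move=> i j /=; rewrite /complete_adj.
  by have [->|/gP->//] := eqVneq i j; rewrite adj_irrefl.
apply: (embeds_twinfree _ gM) => i j /(_ j) /=.
by rewrite /complete_adj eqxx => /negbFE/eqP.
Qed.

Lemma complete_iso (G : sgraph) :
  (forall x y : G, x != y -> x -- y) -> G ≃ 'K_#|G|.
Proof.
move=> cG; apply/iso_sym/embeds_card_iso; last by rewrite card_ord.
apply: (@embeds_complete _ _ enum_val) => i j ij.
by apply: cG; rewrite (inj_eq enum_val_inj).
Qed.

Lemma embeds_small_complete n : n <= 2 -> embeds 'K_n 'P_4.
Proof.
move=> le; pose g (i : 'I_n) : 'P_4 := inord i.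
apply: (@embeds_complete _ _ g) => i j; rewrite -val_eqE /= /path_adj => ij.
have i4 := ltn_ord i; have j4 := ltn_ord j; rewrite /g !inordK; lia.
Qed.

(** Quantification over ['I_n] through the natural numbers below [n], which unlike the
    enumeration of ['I_n] evaluates; finite checks on graphs of fixed size use it. *)
Definition all_lt n (P : nat -> bool) := all P (iota 0 n).

Lemma all_ltP n (P : nat -> bool) : all_lt n P -> forall i : 'I_n, P i.
Proof. by move=> /allP h i; apply: h; rewrite mem_iota /=. Qed.

(** * Graphs of large girth and large chromatic number *)

(** The coordinates of a function are independent: this is the probabilistic content
    of the section, in counting form. *)
Lemma card_constrained (D V : finType) (B : {set D}) (P : D -> {set V}) r :
  (forall x, x \in B -> #|P x| = r) ->
  #|[set s : {ffun D -> V} | [forall x in B, s x \in P x]]|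
    = r ^ #|B| * #|V| ^ (#|D| - #|B|).
Proof.
move=> Pr; pose F x := [pred v | (x \in B) ==> (v \in P x)].
have -> : [set s : {ffun D -> V} | [forall x in B, s x \in P x]]
          = [set s in family F].
  by apply/setP=> s; rewrite !in_set.
rewrite cardsE card_family foldrE big_map big_enum /=.
rewrite (bigID [pred x in B]) /=; congr (_ * _).
  rewrite -prod_nat_const; apply: eq_bigr => x xB; rewrite -(Pr x xB).
  by apply: eq_card => v; rewrite unfold_in xB.
have -> : #|D| - #|B| = #|~: B| by rewrite [RHS]cardsCs setCK.
rewrite -prod_nat_const.
apply: eq_big => [x|x xB]; rewrite ?inE //.
by apply: eq_card => v; rewrite unfold_in (negPf xB).
Qed.

Section RandomGraph.
Variables n C : nat.
Implicit Types s : {ffun 'I_C * 'I_n -> 'I_n}.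

(** Every vertex [u] sends out the [C] arcs from [u] to [s (i, u)], and orientations
    are forgotten. Such a random graph has linearly many edges, one for each coordinate of
    a uniform function. *)
Definition rand_adj s : rel 'I_n := fun u v =>
  (u != v) && [exists i, (s (i, u) == v) || (s (i, v) == u)].

Lemma rand_adj_sym s : symmetric (rand_adj s).
Proof.
move=> u v; rewrite /rand_adj eq_sym; congr (_ && _).
by apply: eq_existsb => i; rewrite orbC.
Qed.

Lemma rand_adj_irrefl s : irreflexive (rand_adj s).
Proof. by move=> u; rewrite /rand_adj eqxx. Qed.

Definition randG s := SGraph (@rand_adj_sym s) (@rand_adj_irrefl s).

Definition independent s (S : {set 'I_n}) : bool :=
  [forall u in S, forall v in S, ~~ rand_adj s u v].

(** If [S] is independent, each of the [C * #|S|] arcs leaving [S] avoids the [q] other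
    vertices of [S]. *)
Lemma count_independent q (S : {set 'I_n}) : #|S| = q.+1 ->
  #|[set s | independent s S]|
    <= (n - q) ^ (C * q.+1) * n ^ (C * n - C * q.+1).
Proof.
move=> cS; pose B : {set 'I_C * 'I_n} := setX setT S.
pose P (x : 'I_C * 'I_n) := ~: (S :\ x.2).
have cB : #|B| = C * q.+1 by rewrite cardsX cardsT card_ord cS.
have := @card_constrained _ _ B P (n - q); rewrite card_prod !card_ord cB => <-.
  apply: subset_leq_card; apply/subsetP=> s; rewrite !inE => /forall_inP iS.
  apply/forall_inP=> -[i u]; rewrite !inE /= => uS; rewrite negb_and negbK.
  have [//|/= su] := eqVneq; apply/negP=> sS.
  have := forall_inP (iS u uS) _ sS; rewrite /rand_adj eq_sym su /=.
  by case/existsP; exists i; rewrite eqxx.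
move=> [i u]; rewrite !inE /= => uS; rewrite cardsCs setCK card_ord.
by have := cardsD1 u S; rewrite uS cS add1n => -[->].
Qed.

Section Witness.
Variable l : nat.

(** A closed walk of length [l.+1] together with the arc that produces each of its
    edges: the index of the arc, and a flag telling whether it is traversed forwards. *)
Definition witness := {ffun 'I_l.+1 -> 'I_n * ('I_C * bool)}.
Implicit Types w : witness.

Definition w_tail w j := if (w j).2.2 then (w j).1 else (w (ordS j)).1.
Definition w_head w j := if (w j).2.2 then (w (ordS j)).1 else (w j).1.
Definition w_slot w j := ((w j).2.1, w_tail w j).

(** The arcs of a cycle occupy distinct coordinates of [s]; requiring it here makes the
    events below independent. *)
Definition realises s w :=
  injectiveb (w_slot w) && [forall j, s (w_slot w j) == w_head w j].

Lemma count_realises w : injective (w_slot w) ->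
  #|[set s | realises s w]| = n ^ (C * n - l.+1).
Proof.
move=> inj; pose B := [set w_slot w j | j : 'I_l.+1].
pose P x := [set v | [forall j, (w_slot w j == x) ==> (v == w_head w j)]].
have cB : #|B| = l.+1 by rewrite card_imset // card_ord.
have := @card_constrained _ _ B P 1; rewrite card_prod !card_ord cB.
rewrite exp1n mul1n => <- => [|x /imsetP[j _ ->]].
  apply: eq_card => s; rewrite !inE /realises; move/injectiveP: (inj) => -> /=.
  apply/forallP/forall_inP => [h x /imsetP[j _ ->]|h j].
    rewrite inE; apply/forallP=> j'; apply/implyP=> /eqP/inj->; exact: h.
  have jB : w_slot w j \in B by apply: imset_f.
  have := h _ jB; rewrite inE => /forallP/(_ j).
  by rewrite eqxx.
rewrite -(cards1 (w_head w j)); apply: eq_card => v; rewrite !inE.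
apply/forallP/eqP => [/(_ j)|-> j']; first by rewrite eqxx => /eqP.
by apply/implyP=> /eqP/inj->.
Qed.

(** The [n] choices of each vertex are paid for by the [n] values of the coordinate of its
    edge, so the average number of witnesses is bounded independently of [n]. *)
Lemma sum_realises :
  \sum_s #|[set w | realises s w]| <= (2 * C) ^ l.+1 * n ^ (C * n).
Proof.
have -> : \sum_s #|[set w | realises s w]| = \sum_w #|[set s | realises s w]|.
  under eq_bigr do rewrite -sum1dep_card big_mkcond.
  by rewrite exchange_big; apply: eq_bigr => w _; rewrite -big_mkcond sum1dep_card.
apply: (@leq_trans (\sum_(w : witness) (l.+1 <= C * n) * n ^ (C * n - l.+1))).
  apply: leq_sum => w _; have [inj|ninj] := injectiveP (w_slot w).
    have := leq_card _ inj; rewrite card_prod !card_ord => -> .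
    by rewrite mul1n count_realises.
  rewrite (_ : #|_| = 0) //; apply: eq_card0 => s; rewrite !inE /realises.
  by case: injectiveP ninj.
rewrite sum_nat_const card_ffun !card_prod !card_ord card_bool.
have [le|_] := leqP l.+1 (C * n); last by rewrite mul0n muln0.
rewrite mul1n -[X in _ <= _ * n ^ X](subnKC le) expnD.
rewrite (_ : n * (C * 2) = 2 * C * n); last lia.
by rewrite expnMn mulnA.
Qed.

End Witness.

Lemma sum_independent q :
  \sum_(s : {ffun 'I_C * 'I_n -> 'I_n})
      #|[set S : {set 'I_n} | (#|S| == q.+1) && independent s S]|
    <= 2 ^ n * ((n - q) ^ (C * q.+1) * n ^ (C * n - C * q.+1)).
Proof.
set X := _ * n ^ _.
have -> : \sum_(s : {ffun 'I_C * 'I_n -> 'I_n})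
      #|[set S : {set 'I_n} | (#|S| == q.+1) && independent s S]| =
   \sum_(S : {set 'I_n} | #|S| == q.+1) #|[set s | independent s S]|.
  under eq_bigr do rewrite -sum1dep_card big_mkcondr.
  by rewrite exchange_big; apply: eq_bigr => S _; rewrite -big_mkcond sum1dep_card.
apply: (@leq_trans (\sum_(S : {set 'I_n} | #|S| == q.+1) X)).
  by apply: leq_sum => S /eqP /count_independent.
rewrite sum_nat_const leq_mul2r; apply/orP; right.
rewrite -[in X in _ <= X](card_ord n) -cardsT -card_powerset.
by apply: subset_leq_card; apply/subsetP=> S _; rewrite inE subsetT.
Qed.

End RandomGraph.

(** Bernoulli's inequality. *)
Lemma expn_succ_double a : 0 < a -> 2 * a ^ a <= a.+1 ^ a.
Proof.
move=> a0; have bern m : a ^ m * (a + m) <= a.+1 ^ m * a.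
  elim: m => [|m IH]; first by rewrite !expn0 addn0.
  rewrite !expnS; nia.
by have := bern a; nia.
Qed.

(** By [count_independent], a given set of [q.+2] vertices is independent with probability at
    most [(a / a.+1) ^ (C * q.+2)]. The choice of [C] makes [(a / a.+1) ^ C] at most
    [2 ^ (- a.+2)], which outweighs the [2 ^ n] candidates: less than one half of an
    independent set is expected. *)
Lemma few_independent a q C n : 0 < a -> C = a * a.+2 -> n = a.+1 * q.+1 ->
  2 * (2 ^ n * ((n - q.+1) ^ (C * q.+2) * n ^ (C * n - C * q.+2))) < n ^ (C * n).
Proof.
move=> a0 CE nE0; have n0 : 0 < n by rewrite nE0.
have nE : n - q.+1 = a * q.+1 by rewrite nE0; lia.
have le : C * q.+2 <= C * n by rewrite leq_mul2l nE0; apply/orP; right; nia.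
rewrite -[X in _ < n ^ X](subnKC le) expnD nE !mulnA ltn_mul2r.
rewrite expn_gt0 n0 /= -expnS.
apply: (@leq_trans (2 ^ (a.+2 * q.+2) * (a * q.+1) ^ (C * q.+2))).
  rewrite ltn_mul2r expn_gt0 muln_gt0 a0 /= ltn_exp2l // nE0; lia.
rewrite !expnM -expnMn leq_exp2r // nE0 !expnMn mulnA leq_mul2r; apply/orP; right.
by rewrite CE !expnM -expnMn leq_exp2r // expn_succ_double.
Qed.

Lemma cycle_nth (T : Type) (e : rel T) x (p : seq T) (j : 'I_(size p).+1) :
  cycle e (x :: p) -> e (nth x (x :: p) j) (nth x (x :: p) (ordS j)).
Proof.
move=> /= /(pathP x)/(_ j); rewrite size_rcons => /(_ (ltn_ord j)).
rewrite -rcons_cons nth_rcons /= ltn_ord nth_rcons.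
have := ltn_ord j; rewrite ltnS leq_eqVlt => /predU1P[jE|lt].
  by rewrite jE ltnn eqxx modnn.
by rewrite lt modn_small.
Qed.

Lemma ordSS_neq N (j : 'I_N) : 2 < N -> ordS (ordS j) != j.
Proof.
move=> N2; apply/eqP => /(congr1 val) /=; have := ltn_ord j.
have [lt _|ge jN] := ltnP j.+1 N; last first.
  have -> : j.+1 = N by lia.
  by rewrite modnn modn_small; lia.
rewrite (modn_small lt); have [lt2|ge2] := ltnP j.+2 N.
  by rewrite modn_small; lia.
by have -> : j.+2 = N by [lia]; rewrite modnn; lia.
Qed.

Section SparseRandomGraph.
Variables n C g : nat.
Implicit Types s : {ffun 'I_C * 'I_n -> 'I_n}.

Definition short_cycles s :=
  \sum_(l < g) #|[set w : witness n C l | realises s w]|.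

(** Starting points of witnesses. A cycle can be started at each of its vertices, so
    deleting these vertices destroys every short cycle. *)
Definition on_short_cycle s : {set 'I_n} :=
  \bigcup_(l < g)
    [set (w ord0).1 | w : witness n C l in [set w : witness n C l | realises s w]].

Lemma card_on_short_cycle s : #|on_short_cycle s| <= short_cycles s.
Proof.
rewrite /on_short_cycle /short_cycles.
elim/big_rec2: _ => [|l m B _ le]; first by rewrite cards0.
by rewrite (leq_trans (leq_card_setU _ _)) // leq_add // leq_imset_card.
Qed.

Lemma ucycle_on_short_cycle s x p :
  ucycle (rand_adj s) (x :: p) -> 2 <= size p < g -> x \in on_short_cycle s.
Proof.
case/andP=> cyc un /andP[ge2 ltg].
pose y (j : 'I_(size p).+1) := nth x (x :: p) j.
have y_inj j j' : y j = y j' -> j = j'.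
  by move/eqP; rewrite /y nth_uniq // => /eqP/ord_inj.
have ordSn (j : 'I_(size p).+1) : ordS (ordS j) != j by apply: ordSS_neq.
have /fin_all_exists[io ioP] (j : 'I_(size p).+1) : exists io : 'I_C * bool,
    s (io.1, if io.2 then y j else y (ordS j)) = if io.2 then y (ordS j) else y j.
  have /andP[_ /existsP[i /orP[]/eqP h]] := cycle_nth j cyc.
    by exists (i, true).
  by exists (i, false).
(* Two edges of a cycle of length at least three are distinct, hence so are their
   arcs: equal arcs traversed in opposite directions would give a 2-cycle. *)
pose w : witness n C (size p) := [ffun j => (y j, io j)].
have tl j : w_tail w j = if (io j).2 then y j else y (ordS j).
  by rewrite /w_tail !ffunE.
have hd j : w_head w j = if (io j).2 then y (ordS j) else y j.
  by rewrite /w_head !ffunE.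
have hdE j : s (w_slot w j) = w_head w j.
  by rewrite /w_slot tl hd ffunE /= ioP.
apply/bigcupP; exists (Ordinal ltg) => //=; apply/imsetP; exists w; last first.
  by rewrite ffunE.
rewrite inE /realises; apply/andP; split; last first.
  by apply/forallP=> j; rewrite hdE.
apply/injectiveP=> j j' jj'.
have := congr1 s jj'; rewrite !hdE !hd; case: jj' => _; rewrite !tl.
do 2![case: ifP => _]; try by move=> /y_inj.
- by move=> /y_inj e1 /y_inj e2; move: (ordSn j'); rewrite -e1 e2 eqxx.
- by move=> /y_inj e1 /y_inj e2; move: (ordSn j'); rewrite -e2 e1 eqxx.
- by move=> _ /y_inj.
Qed.

End SparseRandomGraph.

(** Erdős's theorem. On average over [s] there are at most [D] witnesses of short cycles
    and fewer than one half independent sets of size [q.+2]. Hence some [s] has at most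
    [q = 2 * D] witnesses and no such independent set. Deleting at most [q] of the
    [k.+1 * q.+1] vertices destroys the short cycles and leaves more than [k * q.+1]
    vertices, too many for [k] colour classes of size at most [q.+1]. *)
Theorem large_girth_large_chi g k : exists G : sgraph,
  (forall s : seq G, ucycle (@adj G) s -> size s <= g -> size s < 3) /\
  ~~ colourable G k.
Proof.
wlog k0 : k / 0 < k.
  move=> h; have [G [G1 G2]] := h k.+1 isT; exists G; split=> //.
  apply: contra G2; rewrite -!chi_leq; exact: leqW.
pose K := k.+1; pose C := k * K.+1.
pose D := \sum_(l < g) (2 * C) ^ l.+1.
pose q := 2 * D; pose n := K * q.+1.
pose bad (s : {ffun 'I_C * 'I_n -> 'I_n}) :=
  short_cycles g s +
  q.+1 * #|[set S : {set 'I_n} | (#|S| == q.+2) && independent s S]|.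
(* The weight [q.+1] forces the number of independent sets to vanish. *)
have [s bads] : exists s, bad s < q.+1.
  apply/existsP; apply: contraT; rewrite negb_exists => /forallP h.
  have : \sum_(s : {ffun 'I_C * 'I_n -> 'I_n}) q.+1 <= \sum_s bad s.
    by apply: leq_sum => s _; rewrite leqNgt.
  rewrite sum_nat_const card_ffun card_prod !card_ord leqNgt.
  have W0 : 0 < n ^ (C * n) by rewrite expn_gt0.
  rewrite big_split -big_distrr /=.
  have : \sum_(s : {ffun 'I_C * 'I_n -> 'I_n}) short_cycles g s <= D * n ^ (C * n).
    rewrite exchange_big big_distrl; apply: leq_sum => l _.
    exact: sum_realises.
  have := sum_independent n C q.+1.
  have := few_independent k0 (erefl C) (erefl n).
  rewrite -/K -/C -/n.
  move: (2 ^ n * _) => X; move: (\sum_s _) => Y; move: (\sum_s _) => Z.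
  move: (n ^ _) W0 => W; rewrite /q; nia.
pose G := induced (~: on_short_cycle g s : {set randG s}).
have [ind cyc] : [set S : {set 'I_n} | (#|S| == q.+2) && independent s S] = set0 /\
    short_cycles g s <= q.
  move: bads; rewrite /bad; set I := [set S | _].
  case: (posnP #|I|) => [/eqP|]; last by nia.
  by rewrite cards_eq0 => /eqP->; rewrite cards0 muln0 addn0.
exists G; split=> [[|x t] //= ct tg|].
  rewrite ltnNge; apply/negP => ge.
  have := valP x; rewrite inE => /negP; apply.
  apply: (@ucycle_on_short_cycle _ _ _ _ _ (map val t)); last first.
    by rewrite size_map; move: ge tg => /=; lia.
  case/andP: ct => cy un; apply/andP; split; last first.
    by rewrite -map_cons map_inj_uniq //; apply: val_inj.
  move: cy; rewrite /= -map_rcons.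
  by rewrite path_map.
apply/negP=> /colourableP[f fP].
have cG : #|G| <= \sum_(c < k) q.+1.
  rewrite -sum1_card (partition_big f predT) //=; apply: leq_sum => c _.
  rewrite sum1_card leqNgt; apply/negP=> /card_geqP [t [ut st tP]].
  pose S : {set 'I_n} := [set val x | x in t].
  have : S \in set0; last by rewrite inE.
  rewrite -ind inE card_imset; last exact: val_inj.
  move/card_uniqP: ut => ->; rewrite st eqxx /=.
  apply/forall_inP => _ /imsetP[x xt ->]; apply/forall_inP => _ /imsetP[y yt ->].
  have : ~~ @adj G x y; last by [].
  apply/negP=> /(fP x y); have := tP _ xt; have := tP _ yt; rewrite !unfold_in /=.
  by move=> /eqP/val_inj-> /eqP/val_inj->; rewrite eqxx.
have GE : #|G| = #|~: on_short_cycle g s| by rewrite card_sig; apply: eq_card.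
have := cardsC (on_short_cycle g s); have := card_on_short_cycle g s.
move: cG cyc; rewrite GE sum_nat_const !card_ord.
have : n = q.+1 + k * q.+1 by [].
lia.
Qed.

(** * Joins with complete graphs, the five-cycle and the complement of the seven-cycle *)

Definition no_triple (G : sgraph) : Prop := forall x y z : G,
  x != y -> y != z -> x != z -> [|| x -- y, y -- z | x -- z].

Lemma no_triple_embeds (H G : sgraph) : embeds H G -> no_triple G -> no_triple H.
Proof.
by move=> [f fI fM] nt x y z xy yz xz; rewrite -!fM; apply: nt; rewrite (inj_eq fI).
Qed.

Lemma no_triple_join (G : sgraph) N : no_triple G -> no_triple (G ∨ 'K_N).
Proof.
move=> nt [x|x] [y|y] [z|z] //= xy yz xz; rewrite ?orbT //; first exact: nt.
by apply/orP; left.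
Qed.

(** Colour classes have at most two vertices. *)
Lemma no_triple_card (G : sgraph) k : no_triple G -> colourable G k -> #|G| <= k * 2.
Proof.
move=> nt /colourableP[f fP].
have -> : k * 2 = \sum_(c < k) 2 by rewrite sum_nat_const card_ord.
rewrite -sum1_card (partition_big f predT) //=; apply: leq_sum => c _.
rewrite sum1_card leqNgt; apply/negP=> /card_gt2P[x [y [z [[xc yc zc] [xy yz zx]]]]].
move: xc yc zc; rewrite !unfold_in /= => /eqP/val_inj xc /eqP/val_inj yc /eqP/val_inj zc.
have := nt x y z xy yz; rewrite eq_sym zx => /(_ isT) /or3P[]/fP;
  by rewrite ?xc ?yc ?zc eqxx.
Qed.

(** The complete graph uses up [N] colours that the other side cannot use. *)
Lemma join_colourable (G : sgraph) k N :
  colourable (G ∨ 'K_N) (k + N) -> colourable G k.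
Proof.
move=> /colourableP[f fP]; pose A := [set f (inr j) | j : 'I_N].
have cA : #|A| = N.
  rewrite card_imset ?card_ord // => i j fij; apply/eqP; apply: contraT => ij.
  by have := fP (inr i) (inr j) ij; rewrite fij eqxx.
have <- : #|~: A| = k by have := cardsC A; rewrite cA card_ord; lia.
apply: (@colourable_set _ _ _ (fun x => f (inl x))) => [x|x y xy]; last exact: fP.
rewrite inE; apply/imsetP=> -[j _ fj].
by have := fP (inl x) (inr j) isT; rewrite fj eqxx.
Qed.

Lemma omega_join (G : sgraph) N : omega (G ∨ 'K_N) <= omega G + N.
Proof.
apply: omega_leq => A cA; pose A1 := [set x | inl x \in A].
have cA1 : clique A1.
  apply/cliqueP=> x y; rewrite !inE => xA yA xy.
  exact: (clique_adj cA xA yA).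
have sub : A \subset [set inl x | x in A1] :|: [set inr j | j : 'I_N].
  apply/subsetP=> -[x|j] xA; rewrite inE; apply/orP.
    by left; apply/imsetP; exists x; rewrite ?inE.
  by right; apply/imsetP; exists j.
apply: leq_trans (subset_leq_card sub) _.
apply: leq_trans (leq_card_setU _ _) (leq_add _ _).
  by rewrite (leq_trans (leq_imset_card _ _)) // clique_omega.
by rewrite (leq_trans (leq_imset_card _ _)) // cardT size_enum_ord.
Qed.

(** One graph whose chromatic number exceeds its clique number gives a graph violating any
    prescribed bound: the join with [K_c] raises both by [c]. *)
Lemma join_escapes_bound (F : sgraph -> Prop) c (G : sgraph) k :
    (forall G, F G -> chi G <= maxn c (omega G)) ->
  omega G <= k -> ~~ colourable G k -> ~ F (G ∨ 'K_c).
Proof.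
move=> bound ok /negP nk /bound; rewrite leq_max !chi_leq => le.
apply: nk; apply: (@join_colourable _ _ c); rewrite -chi_leq.
have := omega_join G c; case/orP: le; rewrite -chi_leq; lia.
Qed.

(** A vertex sent to the complete side of the join would be adjacent to all others. *)
Lemma embeds_join_nodom (H G : sgraph) N :
    (forall x : H, exists2 y, y != x & ~~ (x -- y)) ->
  embeds H (G ∨ 'K_N) -> embeds H G.
Proof.
move=> nodom [f fI fM].
have fl x : exists y, f x = inl y.
  case fx: (f x) => [y|j]; first by exists y.
  have [y yx] := nodom x; rewrite -fM fx; case fy: (f y) => [//|i].
  rewrite /= /complete_adj negbK => /eqP ji; case/eqP: yx.
  by apply: fI; rewrite fx fy ji.
have /fin_all_exists[g gP] := fl.
exists g => [x y gxy|x y]; first by apply: fI; rewrite !gP gxy.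
by rewrite -fM !gP.
Qed.

Definition cyc n (i j : nat) := (i != j) && ((i.+1 %% n == j) || (j.+1 %% n == i)).

Section Cycle.
Variable n : nat.
Definition cycle_adj : rel 'I_n := fun i j => cyc n i j.
Lemma cycle_adj_sym : symmetric cycle_adj.
Proof. by move=> i j; rewrite /cycle_adj /cyc eq_sym orbC. Qed.
Lemma cycle_adj_irrefl : irreflexive cycle_adj.
Proof. by move=> i; rewrite /cycle_adj /cyc eqxx. Qed.
Definition cycleG := SGraph cycle_adj_sym cycle_adj_irrefl.
Definition cocycle_adj : rel 'I_n := fun i j => (i != j) && ~~ cyc n i j.
Lemma cocycle_adj_sym : symmetric cocycle_adj.
Proof.
by move=> i j; rewrite /cocycle_adj /cyc eq_sym [(val i == val j)]eq_sym orbC.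
Qed.
Lemma cocycle_adj_irrefl : irreflexive cocycle_adj.
Proof. by move=> i; rewrite /cocycle_adj eqxx. Qed.
Definition cocycleG := SGraph cocycle_adj_sym cocycle_adj_irrefl.
End Cycle.

Lemma no_triple_C5 : no_triple (cycleG 5).
Proof.
have chk : all_lt 5 (fun i => all_lt 5 (fun j => all_lt 5 (fun k =>
    (i != j) ==> (j != k) ==> (i != k) ==> [|| cyc 5 i j, cyc 5 j k | cyc 5 i k]))).
  by vm_compute.
move=> x y z; have /implyP h := all_ltP (all_ltP (all_ltP chk x) y) z.
by move=> xy yz xz; exact: implyP (implyP (h xy) yz) xz.
Qed.

Lemma no_triple_coC7 : no_triple (cocycleG 7).
Proof.
have chk : all_lt 7 (fun i => all_lt 7 (fun j => all_lt 7 (fun k =>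
    ~~ [&& cyc 7 i j, cyc 7 j k & cyc 7 i k]))) by vm_compute.
move=> x y z xy yz xz; have := all_ltP (all_ltP (all_ltP chk x) y) z.
by rewrite /= /cocycle_adj xy yz xz /= !negb_and.
Qed.

Lemma omega_C5 : omega (cycleG 5) <= 2.
Proof.
have chk : all_lt 5 (fun i => all_lt 5 (fun j => all_lt 5 (fun k =>
    ~~ [&& cyc 5 i j, cyc 5 j k & cyc 5 k i]))) by vm_compute.
apply: omega_leq => A cA; rewrite leqNgt; apply/negP.
move=> /card_gt2P[x [y [z [[xA yA zA] [xy yz zx]]]]].
have /negP[] := all_ltP (all_ltP (all_ltP chk x) y) z.
apply/and3P; split; [exact: (clique_adj cA xA yA xy)|
  exact: (clique_adj cA yA zA yz)|exact: (clique_adj cA zA xA zx)].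
Qed.

Lemma omega_coC7 : omega (cocycleG 7) <= 3.
Proof.
pose co i j := (i != j) && ~~ cyc 7 i j.
have chk : all_lt 7 (fun i => all_lt 7 (fun j => all_lt 7 (fun k => all_lt 7 (fun l =>
    ~~ [&& co i j, co i k, co i l, co j k, co j l & co k l])))) by vm_compute.
apply: omega_leq => A cA; rewrite leqNgt; apply/negP.
case/card_geqP=> s [us sz sA]; move: us sz sA.
case: s => [//|x [//|y [//|z [//|w [|//]]]]] us _ sA.
have /negP[] := all_ltP (all_ltP (all_ltP (all_ltP chk x) y) z) w.
have h (u v : 'I_7) : u \in [:: x; y; z; w] -> v \in [:: x; y; z; w] -> u != v -> co u v.
  by move=> /sA uA /sA vA uv; apply: (clique_adj cA uA vA uv).
move: us; rewrite /= !inE !negb_or => /and4P[/and3P[xy xz xw] /andP[yz yw] zw _].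
by rewrite !h ?inE ?eqxx ?orbT.
Qed.

Lemma no_2K2_by_check n (e : nat -> nat -> bool) (G : sgraph) (g : G -> 'I_n) :
    (forall x y, x -- y = e (g x) (g y)) ->
    all_lt n (fun a => all_lt n (fun b => all_lt n (fun c => all_lt n (fun d =>
      [&& e a b & e c d] ==> [|| e a c, e a d, e b c | e b d])))) ->
  ~ embeds (copies 'K_2 2) G.
Proof.
move=> eG chk [f fI fM].
pose u i j : copies 'K_2 2 := (i, j).
have := all_ltP (all_ltP (all_ltP (all_ltP chk (g (f (u ord0 ord0))))
  (g (f (u ord0 ord_max)))) (g (f (u ord_max ord0)))) (g (f (u ord_max ord_max))).
by rewrite -!eG !fM.
Qed.

Lemma no_2K2_C5 : ~ embeds (copies 'K_2 2) (cycleG 5).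
Proof. by apply: (@no_2K2_by_check 5 (cyc 5) (cycleG 5) id) => //; vm_compute. Qed.

Lemma no_2K2_coC7 : ~ embeds (copies 'K_2 2) (cocycleG 7).
Proof.
pose co i j := (i != j) && ~~ cyc 7 i j.
by apply: (@no_2K2_by_check 7 co (cocycleG 7) id) => //; vm_compute.
Qed.

Lemma no_C5_coC7 : ~ embeds (cycleG 5) (cocycleG 7).
Proof.
pose co i j := (i != j) && ~~ cyc 7 i j.
have chk : all_lt 7 (fun a => all_lt 7 (fun b => co a b ==> all_lt 7 (fun c =>
    co b c ==> ~~ co a c ==> all_lt 7 (fun d => co c d ==> ~~ co a d ==> ~~ co b d ==>
    all_lt 7 (fun e => ~~ [&& co d e, co e a, ~~ co e b & ~~ co e c]))))) by vm_compute.
move=> [f fI fM]; pose v i : 'I_7 := f (inord i : 'I_5).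
have cv i j : i < 5 -> j < 5 -> co (v i) (v j) = cyc 5 i j.
  move=> i5 j5; have := fM (inord i) (inord j).
  by rewrite [RHS]/= /cycle_adj !inordK.
have /implyP := all_ltP (all_ltP chk (v 0)) (v 1); rewrite cv // => /(_ isT) c1.
have /implyP := all_ltP c1 (v 2); rewrite !cv // => /(_ isT) /implyP /(_ isT) c2.
have /implyP := all_ltP c2 (v 3).
rewrite !cv // => /(_ isT) /implyP /(_ isT) /implyP /(_ isT) c3.
by have := all_ltP c3 (v 4); rewrite !cv.
Qed.

Lemma C5_not_colourable : ~~ colourable (cycleG 5) 2.
Proof. by apply/negP=> /(no_triple_card no_triple_C5); rewrite card_ord. Qed.

Lemma coC7_not_colourable : ~~ colourable (cocycleG 7) 3.
Proof. by apply/negP=> /(no_triple_card no_triple_coC7); rewrite card_ord. Qed.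

(** * A clique blow-up of the five-cycle *)

Section BlowUp.
Variable s : nat.

(** The cells of the blow-up are numbered along a five-cycle; the non-adjacent cells 1 and
    4 are cliques of size [s.+1], the cells 0, 2 and 3 are single vertices. *)
Definition blowup_vertex : finType := (('I_s.+1 + 'I_s.+1) + 'I_3)%type.

Definition cell (x : blowup_vertex) : nat :=
  match x with
  | inl (inl _) => 1
  | inl (inr _) => 4
  | inr i => nth 0 [:: 0; 2; 3] i
  end.

Definition near i j := (i == j) || cyc 5 i j.

Definition blowup_adj : rel blowup_vertex := fun x y =>
  (x != y) && near (cell x) (cell y).

Lemma near_sym : symmetric near.
Proof. by move=> i j; rewrite /near /cyc (eq_sym i j) [(i.+1 %% 5 == j) || _]orbC. Qed.

Lemma blowup_adj_sym : symmetric blowup_adj.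
Proof. by move=> x y; rewrite /blowup_adj eq_sym near_sym. Qed.

Lemma blowup_adj_irrefl : irreflexive blowup_adj.
Proof. by move=> x; rewrite /blowup_adj eqxx. Qed.

Definition blowup := SGraph blowup_adj_sym blowup_adj_irrefl.

Lemma cell_lt (x : blowup) : cell x < 5.
Proof. by case: x => [[]|[[|[|[|]]]]]. Qed.

Definition cell_ord x : 'I_5 := Ordinal (cell_lt x).

Lemma near_cell (x y : blowup) : x != y -> near (cell x) (cell y) = x -- y.
Proof. by rewrite /= /blowup_adj => ->. Qed.

Lemma cell_single (x y : blowup) :
  cell x \in [:: 0; 2; 3] -> cell y = cell x -> x = y.
Proof.
case: x => [[i|i]|[[|[|[|i]]] ilt]] //; case: y => [[j|j]|[[|[|[|j]]] jlt]] //= _ _;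
  by congr inr; apply: val_inj.
Qed.

Lemma card_blowup : #|blowup| = (s.+2 * 2).+1.
Proof. by rewrite !card_sum !card_ord; lia. Qed.

Lemma no_triple_blowup : no_triple blowup.
Proof.
have chk : all_lt 5 (fun i => all_lt 5 (fun j => all_lt 5 (fun k =>
    [|| near i j, near j k | near i k]))) by vm_compute.
move=> x y z xy yz xz; rewrite -!near_cell //.
exact: (all_ltP (all_ltP (all_ltP chk (cell_ord x)) (cell_ord y)) (cell_ord z)).
Qed.

Lemma blowup_not_colourable : ~~ colourable blowup s.+2.
Proof. by apply/negP=> /(no_triple_card no_triple_blowup); rewrite card_blowup ltnn. Qed.

(** A clique that contains the single vertices of the adjacent cells 2 and 3 contains nothing
    else. Any other clique injects into [option 'I_s.+1], by the indices in the large
    cells and [None] on the single vertices. *)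
Lemma omega_blowup : omega blowup <= s.+2.
Proof.
apply: omega_leq => A cA.
pose a : blowup := inr (@Ordinal 3 1 isT); pose b : blowup := inr (@Ordinal 3 2 isT).
have [aA|aA] := boolP ((a \in A) && (b \in A)).
  have sub : A \subset [set a; b].
    case/andP: aA => aA bA; apply/subsetP=> x xA; rewrite !inE.
    have [//|xa] := eqVneq x a; have [//|xb /=] := eqVneq x b.
    have := clique_adj cA xA aA xa; have := clique_adj cA xA bA xb.
    rewrite /= /blowup_adj; case: x xa xb {xA} => [[i|i]|[[|[|[|i]]] ilt]] //.
  by apply: leq_trans (subset_leq_card sub) _; rewrite cards2; lia.
pose g (x : blowup) : option 'I_s.+1 :=
  match x with inl (inl i) => Some i | inl (inr i) => Some i | inr _ => None end.
have g_inj : {in A &, injective g}.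
  move=> x y xA yA; apply: contra_eq => xy.
  have := clique_adj cA xA yA xy; move: xA yA aA xy.
  rewrite /= /blowup_adj => xA yA aA xy /andP[_].
  case: x xA xy => [[i|i]|[[|[|[|i]]] ilt]] // xA xy;
  case: y yA xy => [[j|j]|[[|[|[|j]]] jlt]] //= yA xy _;
    try by apply: contraNneq xy => -[->].
  - case/negP: aA; have -> : a = inr (Ordinal ilt) by congr inr; apply: val_inj.
    have -> : b = inr (Ordinal jlt) by congr inr; apply: val_inj.
    by rewrite xA.
  - case/negP: aA; have -> : a = inr (Ordinal jlt) by congr inr; apply: val_inj.
    have -> : b = inr (Ordinal ilt) by congr inr; apply: val_inj.
    by rewrite xA yA.
rewrite -(card_in_imset g_inj) (leq_trans (max_card _)) // card_option card_ord.
by [].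
Qed.


(** Two non-adjacent vertices with a common neighbour lie in the two cells next to its own,
    one in each. So the path would lie in two non-adjacent cells and use both of them,
    although it is connected. *)
Lemma no_P4_join_blowup n : 0 < n -> ~ embeds ('P_4 ∨ 'K_n) blowup.
Proof.
have chk : all_lt 5 (fun i => all_lt 5 (fun j => near i j ==> all_lt 5 (fun k =>
    near j k ==> ~~ near i k ==> all_lt 5 (fun l => near k l ==> ~~ near i l ==>
    ~~ near j l ==> all_lt 5 (fun m => ~~ [&& near i m, near j m, near k m & near l m])))))
  by vm_compute.
move=> n0 [f fI fM].
pose p i : 'P_4 ∨ 'K_n := inl (inord i); pose q : 'P_4 ∨ 'K_n := inr (Ordinal n0).
have nc x y : x != y -> near (cell_ord (f x)) (cell_ord (f y)) = x -- y.
  by move=> xy; rewrite near_cell ?(inj_eq fI) // fM.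
have np i j : i < 4 -> j < 4 -> i != j ->
    near (cell_ord (f (p i))) (cell_ord (f (p j))) = (i.+1 == j) || (j.+1 == i).
  move=> i4 j4 ij; rewrite nc /= /path_adj ?inordK //.
  by apply: contraNneq ij => -[/(congr1 val)]; rewrite /= !inordK // => ->.
have := all_ltP (all_ltP chk (cell_ord (f (p 0)))) (cell_ord (f (p 1))).
rewrite np //= => /all_ltP/(_ (cell_ord (f (p 2)))).
rewrite !np //= => /all_ltP/(_ (cell_ord (f (p 3)))).
rewrite !np //= => /all_ltP/(_ (cell_ord (f q))).
by rewrite !nc.
Qed.

(** The common neighbours of the isolated vertex and of the two ends of the edge lie in one
    cell. It contains two of them, so it is one of the large cells, and the ends of the
    edge must share one of the single-vertex cells next to it. *)
Lemma no_K2K1_join_blowup n : 1 < n -> ~ embeds (('K_2 ⊕ 'K_1) ∨ 'K_n) blowup.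
Proof.
have chk : all_lt 5 (fun i => all_lt 5 (fun j => near i j ==> all_lt 5 (fun k =>
    ~~ near i k ==> ~~ near j k ==> all_lt 5 (fun l =>
    [&& near i l, near j l & near k l] ==> all_lt 5 (fun m =>
    [&& near i m, near j m, near k m & near l m] ==>
    ((j == i) && (i \in [:: 0; 2; 3])) || ((m == l) && (l \in [:: 0; 2; 3])))))))
  by vm_compute.
move=> n1 [f fI fM].
pose H := ('K_2 ⊕ 'K_1) ∨ 'K_n.
pose p i : H := inl (inl (inord i)); pose r : H := inl (inr ord0).
pose q0 : H := inr (Ordinal (ltnW n1)); pose q1 : H := inr (Ordinal n1).
have nc x y : x != y -> near (cell_ord (f x)) (cell_ord (f y)) = x -- y.
  by move=> xy; rewrite near_cell ?(inj_eq fI) // fM.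
have p01 : p 0 != p 1.
  by apply/eqP=> -[/(congr1 val)]; rewrite /= !inordK.
have p01' : p 0 -- p 1 by rewrite /= /complete_adj -val_eqE /= !inordK.
have := all_ltP (all_ltP chk (cell_ord (f (p 0)))) (cell_ord (f (p 1))).
rewrite nc // p01' /= => /all_ltP/(_ (cell_ord (f r))).
rewrite !nc //= => /all_ltP/(_ (cell_ord (f q0))).
rewrite !nc //= => /all_ltP/(_ (cell_ord (f q1))).
rewrite !nc //= => /orP[]/andP[/eqP eqc sg].
  by have /fI/eqP := cell_single sg eqc; rewrite (negPf p01).
by have /fI := cell_single sg eqc.
Qed.

End BlowUp.

(** * Forests without three pairwise non-adjacent vertices *)

Lemma embeds_seq (H G : sgraph) (s : seq H) (t : seq G) (y0 : G) :
    (forall x, x \in s) -> size s = size t -> uniq t ->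
    (forall i j, i < j -> j < size s ->
       forall x0, nth x0 s i -- nth x0 s j = nth y0 t i -- nth y0 t j) ->
  embeds H G.
Proof.
move=> sP sz ut adjst; pose f x := nth y0 t (index x s).
have lt x : index x s < size s by rewrite index_mem.
have f_inj : injective f.
  move=> x y /eqP; rewrite nth_uniq ?[X in _ < X](esym sz) //.
  by move/eqP => e; rewrite -(nth_index x (sP x)) e nth_index.
have fM x y : index x s < index y s -> f x -- f y = x -- y.
  by move=> xy; rewrite /f -(adjst _ _ xy (lt y) x) !nth_index.
exists f => // x y; case: (ltngtP (index x s) (index y s)) => [|yx|e].
- exact: fM.
- by rewrite adj_sym fM // adj_sym.
- by rewrite -(nth_index x (sP x)) e nth_index // !adj_irrefl.
Qed.

(** The only graphs on at most three vertices that are not induced subgraphs of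
    the four-vertex path are the triangle and its complement. *)
Lemma embeds_P4_le3 (H : sgraph) :
    no_triple H -> (forall x y z : H, x -- y -> y -- z -> x -- z -> False) ->
  #|H| <= 3 -> embeds H 'P_4.
Proof.
move=> nt no_triangle.
rewrite cardE => le; pose p i : 'P_4 := inord i.
have pp i j : i < 4 -> j < 4 -> path_adj (p i) (p j) = (i.+1 == j) || (j.+1 == i).
  by move=> i4 j4; rewrite /path_adj !inordK.
have pq i j : i < 4 -> j < 4 -> (p i == p j) = (i == j).
  by move=> i4 j4; rewrite -val_eqE /= !inordK.
have H_s x : x \in enum H by rewrite mem_enum.
case: (enum H) (enum_uniq H) le H_s => [|x [|y [|z [|//]]]] us _ H_s.
- by apply: (@embeds_seq _ _ [::] [::] (p 0)).
- by apply: (@embeds_seq _ _ [:: x] [:: p 0] (p 0)) => // -[|i] [|j].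
- apply: (@embeds_seq _ _ [:: x; y] [:: p 0; p (if x -- y then 1 else 2)] (p 0)) => //.
    by rewrite /= inE pq; case: (x -- y).
  by move=> [|[|i]] [|[|j]] //= _ _ _; case: (x -- y); rewrite pp.
move: us; rewrite /= !inE negb_or => /andP[/andP[xy xz] /andP[yz _]].
have key i j k : i < 4 -> j < 4 -> k < 4 -> [&& i != j, i != k & j != k] ->
    x -- y = (i.+1 == j) || (j.+1 == i) -> y -- z = (j.+1 == k) || (k.+1 == j) ->
    x -- z = (i.+1 == k) || (k.+1 == i) -> embeds H 'P_4.
  move=> i4 j4 k4 /and3P[ij ik jk] exy eyz exz.
  apply: (@embeds_seq _ _ [:: x; y; z] [:: p i; p j; p k] (p 0)) => //.
    by rewrite /= !inE !pq // negb_or ij ik jk.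
  by move=> [|[|[|u]]] [|[|[|v]]] //= _ _ _; rewrite pp.
have := nt x y z xy yz xz; have := no_triangle x y z.
case exy: (x -- y); case eyz: (y -- z); case exz: (x -- z) => // h _.
- by case: h.
- exact: (key 0 1 2).
- exact: (key 1 0 2).
- exact: (key 0 1 3).
- exact: (key 0 2 1).
- exact: (key 3 0 1).
- exact: (key 0 3 1).
Qed.
Section Forest.
Variable H : sgraph.
Hypothesis forestH : forest H.
Hypothesis nt : no_triple H.

Lemma forest_cycle (s : seq H) : cycle (@adj H) s -> uniq s -> 2 < size s -> False.
Proof.
move=> cs us; suff : size s < 3 by lia.
by apply: forestH; apply/andP.
Qed.

Lemma no_triangle (x y z : H) : x -- y -> y -- z -> x -- z -> False.
Proof.
move=> xy yz xz; apply: (@forest_cycle [:: x; y; z]) => //=.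
  by rewrite xy yz adj_sym xz.
by rewrite !inE negb_or !adj_neq.
Qed.

Definition nbrs (x : H) := [set y | x -- y].
Definition non_nbrs (x : H) := [set y | (y != x) && ~~ (x -- y)].

Lemma card_nbrs x : #|H| = #|nbrs x| + #|non_nbrs x| + 1.
Proof.
have := cardsC (nbrs x); rewrite (cardsD1 x (~: _)) !inE adj_irrefl /=.
rewrite (_ : ~: nbrs x :\ x = non_nbrs x); first by lia.
by apply/setP=> y; rewrite !inE.
Qed.

Lemma nbrs_le2 x : #|nbrs x| <= 2.
Proof.
rewrite leqNgt; apply/negP=> /card_gt2P[a [b [c [[]]]]].
rewrite !inE => xa xb xc [ab bc]; rewrite eq_sym => ac.
by case/or3P: (nt ab bc ac) => h; [apply: no_triangle xa h xb|
  apply: no_triangle xb h xc|apply: no_triangle xa h xc].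
Qed.

Lemma non_nbrs_adj x a b : a \in non_nbrs x -> b \in non_nbrs x -> a != b -> a -- b.
Proof.
rewrite !inE => /andP[ax xa] /andP[bx xb] ab.
rewrite eq_sym in ax; rewrite eq_sym in bx.
by case/or3P: (nt ax ab bx) => //; rewrite ?(negPf xa) ?(negPf xb).
Qed.

Lemma non_nbrs_le2 x : #|non_nbrs x| <= 2.
Proof.
rewrite leqNgt; apply/negP=> /card_gt2P[a [b [c [[xa xb xc] [ab bc]]]]].
rewrite eq_sym => ac.
exact: no_triangle (non_nbrs_adj xa xb ab) (non_nbrs_adj xb xc bc) (non_nbrs_adj xa xc ac).
Qed.

(** By the bounds above every vertex would have two neighbours and two non-neighbours
    among five vertices, and the graph would be a five-cycle. *)
Lemma card_le4 : #|H| <= 4.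
Proof.
rewrite leqNgt; apply/negP=> gt4.
have /card_gt0P[a _] : 0 < #|H| by lia.
have cN x : #|nbrs x| = 2 /\ #|non_nbrs x| = 2.
  by have := card_nbrs x; have := nbrs_le2 x; have := non_nbrs_le2 x; lia.
have [/eqP/cards2P[b [c [bc Na]]] /eqP/cards2P[d [e [de Ma]]]] := cN a.
have ab : a -- b by have := set21 b c; rewrite -Na inE.
have ac : a -- c by have := set22 b c; rewrite -Na inE.
have dM : d \in non_nbrs a by rewrite Ma set21.
have eM : e \in non_nbrs a by rewrite Ma set22.
have d_e : d -- e := non_nbrs_adj dM eM de.
move: dM eM; rewrite !inE => /andP[da ad] /andP[ea ae].
have nbc : ~~ (b -- c) by apply/negP=> h; apply: no_triangle ab h ac.
have neq u v : a -- u -> ~~ (a -- v) -> u != v by move=> au; apply: contraNneq => <-.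
have other x y : a -- x -> a -- y -> x != y -> ~~ (x -- y) -> x -- d || x -- e.
  move=> ax ay xy nxy; apply: contraT; rewrite negb_or => /andP[xd xe].
  have : 2 < #|non_nbrs x|; last by rewrite ltnNge non_nbrs_le2.
  apply/card_gt2P; exists y, d, e; rewrite !inE nxy xd xe [y == x]eq_sym xy.
  rewrite [d == x]eq_sym [e == x]eq_sym !(neq x) //=; split=> //.
  by rewrite de (neq y d) // eq_sym (neq y e).
have cb : c != b by rewrite eq_sym.
have ncb : ~~ (c -- b) by rewrite adj_sym.
have both (x u v : H) : x -- u -> x -- v -> u -- v -> False.
  by move=> xu xv uv; apply: no_triangle xu uv xv.
(* If the two non-neighbours of [a] are joined to different neighbours of [a], there
   is a five-cycle. *)
have bd_ce (u v : H) : u -- v -> ~~ (a -- u) -> ~~ (a -- v) -> u != a -> v != a ->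
    b -- u -> c -- v -> False.
  move=> uv au av ua va bu cv.
  apply: (@forest_cycle [:: a; b; u; v; c]) => //=.
    by rewrite ab bu uv adj_sym cv adj_sym ac.
  rewrite !inE !negb_or (adj_neq ab) (adj_neq ac) [a == u]eq_sym ua [a == v]eq_sym va.
  by rewrite (adj_neq bu) (neq b v) // bc (adj_neq uv) eq_sym (neq c u) // eq_sym (adj_neq cv).
(* If both neighbours of [a] are joined to the same non-neighbour [u], then [b], [c]
   and the other non-neighbour [v] are pairwise non-adjacent. *)
have same (u v : H) : u -- v -> ~~ (a -- u) -> ~~ (a -- v) -> u != a -> v != a ->
    b -- u -> c -- u -> False.
  move=> uv au av ua va bu cu.
  have bv : ~~ (b -- v) by apply/negP=> bv; apply: both bu bv uv.
  have cv : ~~ (c -- v) by apply/negP=> cv; apply: both cu cv uv.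
  have := nt bc (neq c v ac av) (neq b v ab av).
  by rewrite (negPf nbc) (negPf bv) (negPf cv).
have e_d : e -- d by rewrite adj_sym.
case/orP: (other b c ab ac bc nbc) => hb; case/orP: (other c b ac ab cb ncb) => hc.
- exact: same d_e ad ae da ea hb hc.
- exact: bd_ce d_e ad ae da ea hb hc.
- exact: bd_ce e_d ae ad ea da hb hc.
- exact: same e_d ae ad ea da hb hc.
Qed.

(** A vertex of degree two in such a four-vertex forest is an inner vertex of an
    induced path through all vertices; without one the forest is a perfect matching. *)
Lemma no_triple_forest_2K2 : ~ embeds H 'P_4 -> H ≃ copies 'K_2 2.
Proof.
move=> noP4; have cH : #|H| = 4.
  by have := card_le4; have [/(embeds_P4_le3 nt no_triangle)//|] := leqP #|H| 3; lia.
have noP (w x y z : H) : w -- x -> x -- y -> y -- z ->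
    ~~ (w -- y) -> ~~ (w -- z) -> ~~ (x -- z) -> False.
  move=> wx xy yz wy wz xz; apply: noP4; apply/iso_embeds/iso_sym.
  apply: embeds_card_iso; last by rewrite cH card_ord.
  exact: embeds_twinfree P4_twinfree (p4_map_mono wx xy yz wy wz xz).
have deg1 a : #|nbrs a| <= 1.
  rewrite leqNgt; apply/negP=> gt1.
  have /cards2P[b [c [bc Na]]] : #|nbrs a| == 2 by rewrite eqn_leq nbrs_le2.
  have ab : a -- b by have := set21 b c; rewrite -Na inE.
  have ac : a -- c by have := set22 b c; rewrite -Na inE.
  have [d] : exists d, d \in non_nbrs a.
    by apply/card_gt0P; have := card_nbrs a; have := nbrs_le2 a; lia.
  rewrite inE => /andP[da ad].
  have nbc : ~~ (b -- c) by apply/negP=> bc'; apply: no_triangle ab bc' ac.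
  have bd : b != d by apply: contraNneq ad => <-.
  have cd : c != d by apply: contraNneq ad => <-.
  have dd := nt bc cd bd; rewrite (negPf nbc) /= in dd.
  have [db|db] := boolP (b -- d); have [dc|dc] := boolP (c -- d).
  - apply: (@forest_cycle [:: a; b; d; c]) => //=.
      by rewrite ab db adj_sym dc adj_sym ac.
    by rewrite !inE !negb_or (adj_neq ab) eq_sym da (adj_neq ac) bd bc eq_sym cd.
  - by apply: (noP d b a c); rewrite // adj_sym.
  - by apply: (noP d c a b); rewrite // adj_sym.
  - by move: dd; rewrite (negPf db) (negPf dc).
have /card_gt0P[a _] : 0 < #|H| by rewrite cH.
have cM x : #|nbrs x| == 1 /\ #|non_nbrs x| == 2.
  by have := card_nbrs x; have := deg1 x; have := non_nbrs_le2 x; lia.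
have [/cards1P[b Na] /cards2P[c [d [cd Ma]]]] := cM a.
have ab : a -- b by have := set11 b; rewrite -Na inE.
have cM' : c \in non_nbrs a by rewrite Ma set21.
have dM' : d \in non_nbrs a by rewrite Ma set22.
have c_d := non_nbrs_adj cM' dM' cd.
move: cM' dM'; rewrite !inE => /andP[ca ac] /andP[da ad].
have nb x : x != a -> ~~ (b -- x).
  move=> xa; apply/negP=> bx; have := deg1 b; rewrite leqNgt => /negP[].
  by apply/card_gt1P; exists a, x; rewrite !inE adj_sym ab bx eq_sym.
apply/iso_sym/embeds_card_iso; last by rewrite cH card_prod !card_ord.
by apply: embeds_2K2 ab c_d ac ad (nb c ca) (nb d da).
Qed.

End Forest.

(** * Induced subgraphs of the joins of P4 with a complete graph *)

(** The preimage of the complete side can be smaller, which only changes the size of the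
    complete graph. *)
Lemma join_surj_iso (H A : sgraph) N (f : H -> A ∨ 'K_N) :
    injective f -> {mono f : x y / x -- y} -> (forall a, exists x, f x = inl a) ->
  exists j, H ≃ A ∨ 'K_j.
Proof.
move=> fI fM /fin_all_exists[pre preP].
pose J := [set x | if f x is inr _ then true else false].
have JP x : x \in J -> exists k, f x = inr k.
  by rewrite inE; case: (f x) => // k _; exists k.
exists #|J|; apply: iso_sym; pose h (u : A ∨ 'K_#|J|) : H :=
  match u with inl a => pre a | inr i => enum_val i end.
have fJ (i : 'I_#|J|) : exists k, f (enum_val i) = inr k by apply/JP/enum_valP.
apply: embeds_card_iso.
  exists h => [[a|i] [b|j] /= e|[a|i] [b|j]].
  - by congr inl; have := congr1 f e; rewrite !preP => -[].
  - by have [k fk] := fJ j; have := preP a; rewrite e fk.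
  - by have [k fk] := fJ i; have := preP b; rewrite -e fk.
  - by congr inr; apply: enum_val_inj.
  - by rewrite -fM /= !preP.
  - by have [k fk] := fJ j; rewrite -fM /= preP fk.
  - by have [k fk] := fJ i; rewrite -fM /= preP fk.
  - have [k fk] := fJ i; have [l fl] := fJ j; rewrite -fM /= fk fl /= /complete_adj.
    congr negb; apply/eqP/eqP => [kl|ij].
      by apply/enum_val_inj/fI; rewrite fk fl kl.
    by move: fk; rewrite ij fl => -[].
rewrite card_sum card_ord -(cardsC J) addnC leq_add2r.
have sub : ~: J \subset [set pre a | a : A].
  apply/subsetP=> x; rewrite !inE; case fx: (f x) => [a|//] _.
  by apply/imsetP; exists a => //; apply: fI; rewrite preP.
by rewrite (leq_trans (subset_leq_card sub)) // leq_imset_card.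
Qed.

Definition join_map (A B : sgraph) N (g : A -> B) (u : A ∨ 'K_N) : B ∨ 'K_N :=
  match u with inl a => inl (g a) | inr k => inr k end.

Lemma join_map_inj (A B : sgraph) N (g : A -> B) :
  injective g -> injective (@join_map A B N g).
Proof.
by move=> gI [a|i] [b|j] // [e]; [rewrite (gI _ _ e)|rewrite e].
Qed.

Lemma join_map_mono (A B : sgraph) N (g : A -> B) :
  {mono g : x y / x -- y} -> {mono (@join_map A B N g) : u v / u -- v}.
Proof. by move=> gM [a|i] [b|j] //; apply: gM. Qed.

Lemma embeds_join0 (A : sgraph) : embeds (A ∨ 'K_0) A.
Proof.
have left (u : A ∨ 'K_0) : exists a, u = inl a.
  by case: u => [a|[]//]; exists a.
have /fin_all_exists[f fP] := left; exists f => u v.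
  by move=> fuv; rewrite (fP u) (fP v) fuv.
by rewrite [in RHS](fP u) [in RHS](fP v).
Qed.

Definition K2K1_in_P4 (u : 'K_2 ⊕ 'K_1) : 'P_4 :=
  match u with
  | inl i => @widen_ord 2 4 isT i
  | inr _ => @Ordinal 4 3 isT
  end.

Lemma K2K1_in_P4_mono : {mono K2K1_in_P4 : u v / u -- v}.
Proof.
move=> [i|i] [j|j] /=; rewrite /path_adj /complete_adj ?ord1 //=.
- by case: (ord2_cases i) => ->; case: (ord2_cases j) => ->.
- by case: (ord2_cases i) => ->.
- by case: (ord2_cases j) => ->.
Qed.

Lemma K2K1_in_P4_inj : injective K2K1_in_P4.
Proof.
move=> [i|i] [j|j] /(congr1 val) /=; rewrite ?ord1 //.
- by move=> e; congr inl; apply: val_inj.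
- by case: (ord2_cases i) => ->.
- by case: (ord2_cases j) => ->.
Qed.

Lemma K2K1_in_P4_surj (i : 'P_4) : i != inord 2 -> exists u, K2K1_in_P4 u = i.
Proof.
case: i => [[|[|[|[|k]]]] i4] //; rewrite -val_eqE /= ?inordK // => _.
- by exists (inl ord0); apply: val_inj.
- by exists (inl ord_max); apply: val_inj.
- by exists (inr ord0); apply: val_inj.
Qed.

Lemma P4_rev : {mono (@rev_ord 4 : 'P_4 -> 'P_4) : i j / i -- j}.
Proof.
by move=> [[|[|[|[|i]]]] i4] [[|[|[|[|j]]]] j4].
Qed.

(** Of the three non-edges of the path, any two cover all vertices but one inner vertex,
    or all vertices. *)
Lemma two_nonedges_P4 (i j k l m : 'P_4) :
    i != j -> ~~ (i -- j) -> k != l -> ~~ (k -- l) ->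
    ~~ ((i == k) && (j == l) || (i == l) && (j == k)) ->
    [&& m != i, m != j, m != k & m != l] ->
  ((m == inord 1) || (m == inord 2)) /\
  forall p : 'P_4, p != m -> [|| p == i, p == j, p == k | p == l].
Proof.
have chk : all_lt 4 (fun i => all_lt 4 (fun j => all_lt 4 (fun k => all_lt 4 (fun l =>
    all_lt 4 (fun m =>
    let e a b := (a.+1 == b) || (b.+1 == a) in
    [&& i != j, ~~ e i j, k != l, ~~ e k l,
        ~~ ((i == k) && (j == l) || (i == l) && (j == k))
      & [&& m != i, m != j, m != k & m != l]] ==>
    ((m == 1) || (m == 2)) && all_lt 4 (fun p => (p != m) ==>
       [|| p == i, p == j, p == k | p == l])))))).
  by vm_compute.
have /implyP h := all_ltP (all_ltP (all_ltP (all_ltP (all_ltP chk i) j) k) l) m.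
move=> ij nij kl nkl ne mn.
have /andP[m12 cov] :=
  h (introT and5P (And5 ij nij kl nkl (introT andP (conj ne mn)))).
split=> [|p]; first by rewrite -!val_eqE /= !inordK.
exact: implyP (all_ltP cov p).
Qed.

Lemma P4_join_minus_inner (H : sgraph) N (f : H -> 'P_4 ∨ 'K_N) :
    injective f -> {mono f : x y / x -- y} ->
    (forall x, f x != inl (inord 2)) ->
    (forall p : 'P_4, p != inord 2 -> exists x, f x = inl p) ->
  exists n, H ≃ ('K_2 ⊕ 'K_1) ∨ 'K_n.
Proof.
move=> fI fM no2 cov.
have jI := join_map_inj (N := N) K2K1_in_P4_inj.
have jM := join_map_mono (N := N) K2K1_in_P4_mono.
have /fin_all_exists[g gP] x : exists u, join_map K2K1_in_P4 u = f x.
  case fx: (f x) => [p|k]; last by exists (inr k).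
  have [|u uP] := @K2K1_in_P4_surj p; last by exists (inl u); rewrite /= uP.
  by apply: contraNneq (no2 x) => <-; rewrite fx.
have gI : injective g by move=> x y gxy; apply: fI; rewrite -!gP gxy.
have gM : {mono g : x y / x -- y} by move=> x y; rewrite -fM -!gP jM.
apply: (join_surj_iso gI gM) => a.
have [|x fx] := cov (K2K1_in_P4 a).
  by rewrite -val_eqE /= inordK //; case: a => [i|i] //=; case: (ord2_cases i) => ->.
by exists x; apply: jI; rewrite gP fx.
Qed.

Lemma nonadj_join (H A : sgraph) N (f : H -> A ∨ 'K_N) x y :
    injective f -> {mono f : x y / x -- y} -> x != y -> ~~ (x -- y) ->
  exists i j, [/\ f x = inl i, f y = inl j, i != j & ~~ (i -- j)].
Proof.
move=> fI fM xy; rewrite -fM; have : f x != f y by rewrite (inj_eq fI).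
case: (f x) (f y) => [i|k] [j|l] //= ij nij.
  by exists i, j.
by case/negP: nij.
Qed.

Lemma one_nonedge_iso (H : sgraph) (a b : H) : a != b -> ~~ (a -- b) ->
    (forall c d : H, c != d -> ~~ (c -- d) -> [set c; d] = [set a; b]) ->
  exists a' b' : 'K_#|H|, a' -- b' /\ H ≃ del_edge a' b'.
Proof.
move=> ab nab uniq_ne; exists (enum_rank a), (enum_rank b); split.
  by rewrite /= /complete_adj (inj_eq enum_rank_inj).
exists enum_rank; first exact: enum_rank_bij.
move=> x y; rewrite /= /del_edge_adj /= /complete_adj (inj_eq enum_rank_inj).
have [->|xy] := eqVneq x y; first by rewrite adj_irrefl.
rewrite -!(imset_set1 enum_rank) -!imsetU (inj_eq (imset_inj enum_rank_inj)) /=.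
apply/idP/idP=> [|xyadj]; first by apply: contraNT => /(uniq_ne _ _ xy)->.
apply/eqP=> e; have : x \in [set a; b] by rewrite -e set21.
have : y \in [set a; b] by rewrite -e set22.
move=> /set2P[] yE /set2P[] xE; move: xyadj xy; rewrite xE yE ?eqxx ?(negPf nab) //.
by rewrite adj_sym (negPf nab).
Qed.

(** Distinguish by the number of pairs of distinct non-adjacent vertices. With none the
    graph is complete, with one it is complete minus an edge. With two such pairs its image
    contains all vertices of [P_4], or all but an inner one; removing an inner vertex from
    the path leaves [K_2 + K_1]. *)
Theorem P4_join_classX (H : sgraph) N :
  embeds H ('P_4 ∨ 'K_N) -> ~ embeds H 'P_4 -> classX H.
Proof.
move=> [f fI fM] noP4.
have [/existsP[[a b] /= /andP[ab nab]]|all_adj] :=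
    boolP [exists u : H * H, (u.1 != u.2) && ~~ (u.1 -- u.2)]; last first.
  have cH : H ≃ 'K_#|H|.
    apply: complete_iso => x y xy; apply: contraNT all_adj => nxy.
    by apply/existsP; exists (x, y); rewrite /= xy.
  constructor 4; exists #|H| => //; rewrite ltnNge; apply/negP=> le2.
  by apply: noP4; apply: embeds_trans (iso_embeds cH) (embeds_small_complete le2).
have [/existsP[[c d] /= /and3P[cd ncd ne]]|one] :=
    boolP [exists u : H * H, [&& u.1 != u.2, ~~ (u.1 -- u.2)
                                & [set u.1; u.2] != [set a; b]]]; last first.
  have uniq_ne (x y : H) : x != y -> ~~ (x -- y) -> [set x; y] = [set a; b].
    move=> xy nxy; apply/eqP; apply: contraNT one => ne.
    by apply/existsP; exists (x, y); rewrite /= xy nxy.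
  constructor 3; exists #|H|; last exact: one_nonedge_iso ab nab uniq_ne.
  rewrite ltnNge; apply/negP=> le3; apply: noP4; apply: embeds_P4_le3 => //.
    move=> x y z xy yz xz; apply: contraT; rewrite !negb_or => /and3P[nxy nyz nxz].
    have : z \in [set x; y].
      by rewrite (uniq_ne _ _ xy nxy) -(uniq_ne _ _ xz nxz) set22.
    by rewrite !inE ![z == _]eq_sym (negPf yz) (negPf xz).
  move=> x y z xy yz xz.
  have full u : u \in [set x; y; z].
    have : [set x; y; z] == setT.
      rewrite eqEcard subsetT cardsT (leq_trans le3) // setUC cardsU1 cards2 !inE.
      by rewrite negb_or [z == x]eq_sym [z == y]eq_sym !adj_neq.
    by move/eqP=> ->.
  case/negP: nab; move: (full a) (full b) ab; rewrite !inE.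
  by case/orP=> [/orP[]|] /eqP->; case/orP=> [/orP[]|] /eqP->; rewrite ?eqxx // 1?adj_sym.
have [i [j [fa fb ij nij]]] := nonadj_join fI fM ab nab.
have [k [l [fc fd kl nkl]]] := nonadj_join fI fM cd ncd.
have ijkl : ~~ ((i == k) && (j == l) || (i == l) && (j == k)).
  apply/negP=> /orP[]/andP[/eqP e1 /eqP e2]; case/eqP: ne.
    have -> : a = c by apply: fI; rewrite fa fc e1.
    by have -> : b = d by apply: fI; rewrite fb fd e2.
  have -> : a = d by apply: fI; rewrite fa fd e1.
  have -> : b = c by apply: fI; rewrite fb fc e2.
  by rewrite setUC.
have [surj|] := boolP [forall p : 'P_4, [exists x, f x == inl p]].
  have [|n isoH] := join_surj_iso fI fM.
    by move=> p; have /existsP[x /eqP] := forallP surj p; exists x.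
  constructor 1; exists n => //; rewrite lt0n; apply/negP=> /eqP n0.
  apply: noP4; rewrite n0 in isoH.
  exact: embeds_trans (iso_embeds isoH) (embeds_join0 _).
rewrite negb_forall => /existsP[m]; rewrite negb_exists => /forallP miss.
have mne x p : f x = inl p -> m != p.
  by move=> fx; apply: contraNneq (miss x) => ->; apply/eqP.
have [|m12 cov] := @two_nonedges_P4 i j k l m ij nij kl nkl ijkl.
  by apply/and4P; split; apply: mne; [exact: fa|exact: fb|exact: fc|exact: fd].
have cover (p : 'P_4) : p != m -> exists x, f x = inl p.
  by move/cov => /or4P[]/eqP->; [exists a|exists b|exists c|exists d].
have [n isoH] : exists n, H ≃ ('K_2 ⊕ 'K_1) ∨ 'K_n.
  case/orP: m12 => /eqP mE; last first.
    apply: (P4_join_minus_inner fI fM) => [x|p p2]; first by rewrite -mE miss.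
    by apply: cover; rewrite mE.
  (* Reversing the path exchanges its two inner vertices. *)
  have rI := join_map_inj (N := N) (g := @rev_ord 4 : 'P_4 -> 'P_4) (@rev_ord_inj 4).
  have rM := join_map_mono (N := N) P4_rev.
  have rev1 : @rev_ord 4 (inord 1) = inord 2 by apply: val_inj; rewrite /= !inordK.
  apply: (@P4_join_minus_inner _ N (fun x => join_map (@rev_ord 4 : 'P_4 -> 'P_4) (f x))).
  - by move=> x y /rI/fI.
  - by move=> x y; rewrite rM.
  - move=> x; apply: contraNneq (miss x); case: (f x) => // p [].
    by rewrite -rev1 -mE => /rev_ord_inj->.
  move=> p p2; have [|x fx] := cover (rev_ord p).
    by apply: contraNneq p2 => e; rewrite -rev1 -mE -e rev_ordK.
  by exists x; rewrite fx /= rev_ordK.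
constructor 2; exists n => //; rewrite lt0n; apply/negP=> /eqP n0; rewrite n0 in isoH.
apply: noP4; apply: embeds_trans (iso_embeds isoH) _.
apply: embeds_trans (embeds_join0 _) _.
by exists K2K1_in_P4; [exact: K2K1_in_P4_inj|exact: K2K1_in_P4_mono].
Qed.

(** * Choosing colours from nearly cross-free lists *)

(** Vertices [v] are given lists [F v] of colours in a large set [K], with at least two
    colours each. The lists of adjacent vertices share at most one colour, and nearly cover
    [K], up to [m] colours, if they do share one; the lists of non-adjacent vertices are
    nested or nearly cover [K]. Any choice of colours from the lists is then proper, except
    possibly along the edges called conflicts here, whose lists meet in one colour and are
    nearly complementary. The sets [E1] and [E2] below are two disjoint palettes that resolve
    the conflicts with very large lists and the remaining ones. *)
Section ColourChoice.
Variables (V U : finType) (e : rel V) (K : {set U}) (F : V -> {set U}) (m : nat).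
Hypothesis e_sym : symmetric e.
Hypothesis FK : forall v, F v \subset K.
Hypothesis F_gt1 : forall v, 1 < #|F v|.
Hypothesis adj_meet1 : forall v w, e v w -> #|F v :&: F w| <= 1.
Hypothesis adj_cover : forall v w,
  e v w -> F v :&: F w != set0 -> #|K :\: (F v :|: F w)| <= m.
Hypothesis nadj_nested : forall v w, ~~ e v w ->
  [\/ F v \subset F w, F w \subset F v | #|K :\: (F v :|: F w)| <= m].
Hypothesis K_big : (3 * m + 8) ^ 2 <= #|K|.

(* Sets that miss at most [m.+1] colours of a set of size [t] share two of its colours.
   Only lists of size at most [t'] can be in conflict with one that misses at most
   [t + m] colours of [K]. *)
Let t := 2 * m + 4.
Let t' := t + m + 1.

Definition conflict v w := e v w && (F v :&: F w != set0).

Lemma K_linear : 10 * m + 60 <= #|K|.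
Proof. by apply: leq_trans K_big; rewrite -mulnn; nia. Qed.

Lemma card_union_split v w :
  #|F v| + #|F w| + #|K :\: (F v :|: F w)| = #|K| + #|F v :&: F w|.
Proof.
have := cardsUI (F v) (F w); have := cardsID (F v :|: F w) K.
by rewrite (setIidPr _) ?subUset ?FK //; lia.
Qed.

Lemma conflict_sym v w : conflict v w = conflict w v.
Proof. by rewrite /conflict e_sym setIC. Qed.

Lemma conflictP v w : conflict v w ->
  #|F v :&: F w| = 1 /\ #|K :\: (F v :|: F w)| <= m.
Proof.
case/andP=> vw ne; split; last exact: adj_cover.
by apply/eqP; rewrite eqn_leq adj_meet1 // card_gt0.
Qed.

(** Two small lists are far from covering [K], so if they meet, they are nested.
    This is why their union over a given colour stays small. *)
Lemma small_laminar v w : #|F v| <= t' -> #|F w| <= t' ->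
  F v :&: F w != set0 -> F v \subset F w \/ F w \subset F v.
Proof.
move=> sv sw ne.
have big : #|K :\: (F v :|: F w)| <= m -> #|K| + #|F v :&: F w| <= 2 * t' + m.
  by have := card_union_split v w; lia.
have notbig : ~ (#|K :\: (F v :|: F w)| <= m).
  by move/big; have := K_linear; rewrite /t' /t; lia.
have [vw|/nadj_nested[]] := boolP (e v w); [|by left|by right|by []].
by have [] := notbig (adj_cover vw ne).
Qed.

Definition small_hull a := a |: \bigcup_(v | (#|F v| <= t') && (a \in F v)) F v.

Lemma card_small_hull a : #|small_hull a| <= t'.+1.
Proof.
rewrite /small_hull cardsU1.
suff : #|\bigcup_(v | (#|F v| <= t') && (a \in F v)) F v| <= t'.
  by case: (_ \notin _); lia.
have [v0 P0|none] := pickP [pred v | (#|F v| <= t') && (a \in F v)]; last first.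
  by rewrite big_pred0 ?cards0.
case: (arg_maxnP (fun v => #|F v|) P0) => v /andP[sv av] vmax.
apply: leq_trans (sv); apply/subset_leq_card/bigcupsP => w /andP[sw aw].
have ne : F w :&: F v != set0 by apply/set0Pn; exists a; rewrite inE aw.
have [//|vw] := small_laminar sw sv ne.
have wv : #|F w| <= #|F v| by apply: vmax; rewrite /= sw.
by have /eqP-> : F v == F w by rewrite eqEcard vw.
Qed.

(** Greedily: a new colour has to avoid [E2] and the small lists through the colours
    chosen before, which are few. *)
Lemma small_transversal (E2 : {set U}) k : k * t'.+1 + #|E2| <= #|K| ->
  exists E1 : {set U}, [/\ E1 \subset K, #|E1| = k, [disjoint E1 & E2] &
    forall v, #|F v| <= t' -> #|F v :&: E1| <= 1].
Proof.
elim: k => [|k IH] le.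
  exists set0; rewrite sub0set cards0 disjoints_subset sub0set; split=> // v _.
  by rewrite setI0 cards0.
have [|E1 [E1K cE1 dE1 trE1]] := IH; first by move: le; rewrite mulSn; lia.
pose N := E2 :|: \bigcup_(a in E1) small_hull a.
have cN : #|N| <= k * t'.+1 + #|E2|.
  rewrite addnC (leq_trans (leq_card_setU _ _)) // leq_add2l -cE1 -sum_nat_const.
  elim/big_rec2: _ => [|a S n _ IHn]; first by rewrite cards0.
  by rewrite (leq_trans (leq_card_setU _ _)) // leq_add // card_small_hull.
have [a aK aN] : exists2 a, a \in K & a \notin N.
  have /subsetPn[a aK aN] : ~~ (K \subset N); last by exists a.
  apply/negP=> /subset_leq_card le2; move: le; rewrite mulSn; lia.
move: aN; rewrite !inE negb_or => /andP[aE2 /bigcupP aU].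
have aE1 : a \notin E1.
  by apply/negP=> aE1; apply: aU; exists a; rewrite // !inE eqxx.
exists (a |: E1); split.
- by rewrite subUset sub1set aK.
- by rewrite cardsU1 aE1 cE1.
- by rewrite disjoints_subset subUset sub1set inE aE2 -disjoints_subset.
move=> v sv; have [av|av] := boolP (a \in F v); last first.
  apply: leq_trans (trE1 v sv); apply/subset_leq_card/subsetP => x.
  by rewrite !inE => /andP[xv /predU1P[xa|->]]; rewrite xv // -xa xv in av *.
rewrite -(cards1 a); apply/subset_leq_card/subsetP => x; rewrite !inE.
case/andP=> xv /predU1P[->|xE1] //; case: aU; exists x => //.
by rewrite 2!inE; apply/orP; right; apply/bigcupP; exists v; rewrite ?sv.
Qed.

(** The conflicts between lists that are not small. They behave like nearly
    complementary, pairwise cross-free bipartitions of [K]. *)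
Definition relevant v w := [&& conflict v w, t < #|F v| & t < #|F w|].

(** Take for [R] the smallest list occurring in a relevant conflict. If both lists of
    another relevant conflict met [R] twice, neither could be comparable with [R], by
    minimality and because they share one colour only. So each would nearly cover
    [K] together with [R], and [R] would be almost all of [K], whereas [R] is the smaller
    of two nearly disjoint lists. *)
Lemma root_region : exists2 R : {set U}, R \subset K /\ t <= #|R| &
  forall v w, relevant v w -> #|R :\: F v| <= m.+1 \/ #|R :\: F w| <= m.+1.
Proof.
have [v0 P0|none] := pickP [pred v | [exists w, relevant v w]]; last first.
  exists K; first by split=> //; have := K_linear; rewrite /t; lia.
  by move=> v w vw; have /existsP[] := none v; exists w.
case: (arg_minnP (fun v => #|F v|) P0) => v /existsP[w vw] vmin.
have /and3P[cvw tv tw] := vw.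
exists (F v); first by split=> //; lia.
have sz : #|F v| <= #|F w|.
  apply: vmin; apply/existsP; exists v; move: vw.
  by rewrite /relevant conflict_sym [in X in X -> _]andbA [in X in X -> _]andbAC -andbA.
have [c1 _] := conflictP cvw.
move=> x y xy; have /and3P[cxy _ _] := xy; have [cI cU] := conflictP cxy.
have yx : relevant y x by move: xy; rewrite /relevant conflict_sym => /and3P[-> -> ->].
have half (a b : V) : relevant a b -> #|F v :&: F a| <= 1 -> #|F v :\: F b| <= m.+1.
  move=> /and3P[cab _ _] le1; have [_ cUab] := conflictP cab.
  suff sub : F v :\: F b \subset (F v :&: F a) :|: (K :\: (F a :|: F b)).
    apply: leq_trans (subset_leq_card sub) _.
    by rewrite (leq_trans (leq_card_setU _ _)) // -add1n leq_add.
  apply/subsetP=> z; rewrite !inE => /andP[zb zv]; rewrite zv (negPf zb) orbF /=.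
  by rewrite (subsetP (FK v)) // andbT orbN.
have [le1|gx] := leqP #|F v :&: F x| 1; first by right; apply: half le1.
have [le1|gy] := leqP #|F v :&: F y| 1; first by left; apply: half le1.
exfalso.
have cover (a b : V) : relevant a b -> 1 < #|F v :&: F a| -> 1 < #|F v :&: F b| ->
    #|K :\: (F v :|: F a)| <= m.
  move=> ab ga gb; have /and3P[cab _ _] := ab; have [cIab _] := conflictP cab.
  have nva : ~~ e v a by apply/negP=> /adj_meet1; rewrite leqNgt ga.
  have [sub|sub|//] := nadj_nested nva.
    have : #|F v :&: F b| <= #|F a :&: F b| by apply/subset_leq_card/setSI.
    by rewrite cIab => le; have := leq_trans gb le.
  have le : #|F v| <= #|F a| by apply: vmin; apply/existsP; exists b.
  have /eqP eqF : F a == F v by rewrite eqEcard sub.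
  by move: gb; rewrite -eqF cIab.
have kx := cover _ _ xy gx gy; have ky := cover _ _ yx gy gx.
have sub : K :\: F v \subset
    (K :\: (F v :|: F x)) :|: (K :\: (F v :|: F y)) :|: (F x :&: F y).
  apply/subsetP=> z; rewrite !inE => /andP[/negPf-> ->] /=.
  by case: (z \in F x); case: (z \in F y).
have := subset_leq_card sub.
have := (leq_card_setU (K :\: (F v :|: F x) :|: K :\: (F v :|: F y)) (F x :&: F y)).1.
have := (leq_card_setU (K :\: (F v :|: F x)) (K :\: (F v :|: F y))).1.
have := card_union_split v w; have := cardsID (F v) K.
rewrite (setIidPr (FK v)); have := K_linear; clear K_big; lia.
Qed.

Lemma subset_of_card (A : {set U}) k : k <= #|A| ->
  exists2 B : {set U}, B \subset A & #|B| = k.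
Proof.
case/card_geqP=> s [us <- sA]; exists [set x in s].
  by apply/subsetP=> x; rewrite inE; apply: sA.
by rewrite cardsE; apply/card_uniqP.
Qed.

(** Colours are taken from [E1] for very large lists ([H]), from [E2] for the other lists of
    relevant conflicts that contain almost all of [R] ([W]), and outside these palettes
    for the remaining lists, as far as needed. Very large lists pairwise meet twice, and
    so do those in [W], hence there is no edge inside [H] or inside [W]. A conflict
    outside [H] is relevant, since a small list can only be complementary to a very large
    one, and then [root_region] puts one of its ends in [W]. Thus every conflict joins
    vertices coloured from different palettes. Avoiding [E1] is possible since small lists
    meet it at most once and have two colours. *)
Theorem conflict_free_choice :
  exists c : V -> U, forall v w, (c v \in F v) /\ (e v w -> c v != c w).
Proof.
have [R [RK tR] root] := root_region.
have [|E2 E2R cE2] := @subset_of_card R m.+2; first by move: tR; rewrite /t; lia.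
have [|E1 [E1K cE1 dE trE1]] := @small_transversal E2 t'.
  by rewrite cE2; move: K_big; rewrite -mulnn /t' /t; nia.
pose H v := #|K| <= #|F v| + t + m.
pose W v := [&& ~~ H v, t < #|F v| & #|R :\: F v| <= m.+1].
pose P v x := (x \in F v) && (if H v then x \in E1 else if W v then x \in E2
  else ((#|F v| <= t') ==> (x \notin E1)) && ((t < #|F v|) ==> (x \notin E2))).
have cK v : #|K :\: F v| = #|K| - #|F v| by rewrite cardsDS.
have /fin_all_exists[c cP] v : exists x, P v x.
  rewrite /P; have [Hv|nH] := boolP (H v); last have [Wv|nW] := boolP (W v).
  - have [x xE1 xF] : exists2 x, x \in E1 & x \in F v; last by exists x; rewrite xF.
    have /subsetPn[x xE1 xF] : ~~ (E1 \subset K :\: F v).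
      apply/negP=> /subset_leq_card; rewrite cE1 cK; move: Hv; rewrite /H /t'; lia.
    by exists x => //; move: xF; rewrite inE (subsetP E1K) // andbT negbK.
  - have [x xE2 xF] : exists2 x, x \in E2 & x \in F v; last by exists x; rewrite xF.
    have /subsetPn[x xE2 xF] : ~~ (E2 \subset R :\: F v).
      by apply/negP=> /subset_leq_card; rewrite cE2; case/and3P: Wv; lia.
    by exists x => //; move: xF; rewrite inE (subsetP E2R) // andbT negbK.
  pose B := (if #|F v| <= t' then E1 else set0) :|: (if t < #|F v| then E2 else set0).
  have [x xF xB] : exists2 x, x \in F v & x \notin B.
    have /subsetPn[x xF xB] : ~~ (F v \subset B); last by exists x.
    apply/negP=> /setIidPl FB.
    have : #|F v :&: B| <=
        (if #|F v| <= t' then 1 else 0) + (if t < #|F v| then m.+2 else 0).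
      rewrite /B setIUr (leq_trans (leq_card_setU _ _)) // leq_add //.
        by case: ifP => [/trE1//|_]; rewrite setI0 cards0.
      case: ifP => _; last by rewrite setI0 cards0.
      by rewrite -cE2 subset_leq_card // subsetIr.
    by rewrite FB; have := F_gt1 v; rewrite /t' /t; do 2!case: ifP; lia.
  exists x; rewrite xF /=; move: xB; rewrite inE negb_or.
  by do 2!case: ifP => _; rewrite ?inE /= ?andbT.
have H_E1 v : H v -> c v \in E1 by move=> Hv; have := cP v; rewrite /P Hv => /andP[].
have W_E2 v : W v -> c v \in E2.
  move=> Wv; have /and3P[nH _ _] := Wv.
  by have := cP v; rewrite /P (negPf nH) Wv => /andP[].
have nE1 v : ~~ H v -> ~~ W v -> #|F v| <= t' -> c v \notin E1.
  move=> nH nW sv; have := cP v; rewrite /P (negPf nH) (negPf nW) sv /=.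
  by case/and3P.
have nE2 v : ~~ H v -> ~~ W v -> t < #|F v| -> c v \notin E2.
  move=> nH nW sv; have := cP v; rewrite /P (negPf nH) (negPf nW) sv /=.
  by case/and3P.
have sum v w : conflict v w -> #|K| < #|F v| + #|F w| + m <= #|K| + m + 1.
  by case/conflictP; have := card_union_split v w; clear; lia.
have KL := K_linear.
have HtoS v w : conflict v w -> H v -> #|F w| <= t'.
  by move/sum; rewrite /H /t' /t; clear; lia.
have StoH v w : conflict v w -> #|F w| <= t -> H v.
  by move/sum; rewrite /H /t' /t; clear; lia.
have noHH v w : conflict v w -> H v -> ~~ H w.
  move/sum; rewrite /H /t => cvw Hv; apply/negP=> Hw.
  by move: cvw Hv Hw KL; clear; lia.
have noEqH v w : conflict v w -> H v -> c v != c w.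
  move=> cvw Hv; have nHw := noHH _ _ cvw Hv; have cv := H_E1 _ Hv.
  have [Ww|nWw] := boolP (W w).
    apply: contraTneq (W_E2 _ Ww) => <-.
    by move: dE; rewrite disjoints_subset => /subsetP/(_ _ cv); rewrite inE.
  by apply: contraNneq (nE1 _ nHw nWw (HtoS _ _ cvw Hv)) => <-.
have noEqW v w : conflict v w -> W v -> ~~ H w -> c v != c w.
  move=> cvw Wv nHw; have [Ww|nWw] := boolP (W w).
    have [cI _] := conflictP cvw; case/and3P: Wv => _ _ Rv; case/and3P: Ww => _ _ Rw.
    have sub : R \subset (R :\: F v) :|: (R :\: F w) :|: (F v :&: F w).
      by apply/subsetP=> z zR; rewrite !inE zR; case: (z \in F v); case: (z \in F w).
    have := subset_leq_card sub.
    have := (leq_card_setU (R :\: F v :|: R :\: F w) (F v :&: F w)).1.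
    have := (leq_card_setU (R :\: F v) (R :\: F w)).1.
    by move: Rv Rw tR; rewrite cI /t; clear; lia.
  have tw : t < #|F w|.
    rewrite ltnNge; apply/negP=> sw; case/and3P: Wv => /negP[].
    exact: StoH cvw sw.
  by apply: contraNneq (nE2 _ nHw nWw tw) => <-; apply: W_E2.
have noEq v w : conflict v w -> c v != c w.
  move=> cvw; have cwv : conflict w v by rewrite conflict_sym.
  have [Hv|nHv] := boolP (H v); first exact: noEqH.
  have [Hw|nHw] := boolP (H w); first by rewrite eq_sym; apply: noEqH.
  have [Wv|nWv] := boolP (W v); first exact: noEqW.
  have [Ww|nWw] := boolP (W w); first by rewrite eq_sym; apply: noEqW.
  have tv : t < #|F v| by rewrite ltnNge; apply: contra nHw => /(StoH _ _ cwv).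
  have tw : t < #|F w| by rewrite ltnNge; apply: contra nHv => /(StoH _ _ cvw).
  have [|Rv|Rw] := root v w; first by rewrite /relevant cvw tv.
    by case/negP: nWv; rewrite /W nHv tv.
  by case/negP: nWw; rewrite /W nHw tw.
exists c => v w; split=> [|vw]; first by case/andP: (cP v).
apply/eqP=> cvw; suff /noEq : conflict v w by rewrite cvw eqxx.
rewrite /conflict vw; apply/set0Pn; exists (c v); rewrite inE.
by case/andP: (cP v) => ->; rewrite cvw; case/andP: (cP w) => ->.
Qed.

End ColourChoice.

(** * Graphs without 2K2 and without a join of P4 with a complete graph *)

(** Fix a maximum clique [K]. The column of [a \in K] consists of the vertices that miss
    exactly [a] in [K]; it contains [a] and is independent. The column of [a] gets
    colour [a], so a colour is available for [v] if [v] has no neighbour in its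
    column: these colours form [free v]. *)
Section Columns.
Variables (G : sgraph) (K : {set G}).
Hypothesis no2K2 : forall a b c d : G,
  a -- b -> c -- d -> [|| a -- c, a -- d, b -- c | b -- d].
Hypothesis K_clique : clique K.
Hypothesis K_max : forall A : {set G}, clique A -> #|A| <= #|K|.

Definition missed v := [set a in K | ~~ (a -- v)].
Definition in_column a v := missed v == [set a].

Lemma missed_neq0 v : missed v != set0.
Proof.
apply: contraTneq (leqnn #|K|) => M0; rewrite -ltnNge.
have adjK a : a \in K -> a -- v.
  by move=> aK; have := in_set0 a; rewrite -M0 inE aK => /negbFE.
have vK : v \notin K by apply/negP => /adjK; rewrite adj_irrefl.
have <- : #|v |: K| = #|K|.+1 by rewrite cardsU1 vK.
by apply: K_max; apply: clique_add => // x xK; rewrite adj_sym; apply: adjK.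
Qed.

Lemma column_self a : a \in K -> in_column a a.
Proof.
move=> aK; rewrite /in_column eqEsubset sub1set inE aK adj_irrefl andbT.
apply/subsetP=> b; rewrite !inE => /andP[bK]; apply: contraR => ba.
exact: (clique_adj K_clique).
Qed.

Lemma column_mem a v : in_column a v -> a \in K.
Proof. by move/eqP=> Mv; have := set11 a; rewrite -Mv inE => /andP[]. Qed.

Lemma column_nadj_root a v : in_column a v -> ~~ (a -- v).
Proof. by move/eqP=> Mv; have := set11 a; rewrite -Mv inE => /andP[]. Qed.

Lemma column_adj_root a b v : in_column a v -> b \in K -> b != a -> b -- v.
Proof.
move=> /eqP Mv bK; apply: contraR => bv.
by rewrite -in_set1 -Mv inE bK.
Qed.

Lemma column_nadj a x y : in_column a x -> in_column a y -> ~~ (x -- y).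
Proof.
move=> ax ay; have aK := column_mem ax; apply/negP=> xy.
have notK z : in_column a z -> z \in K -> z = a.
  move=> az zK; apply/set1P; rewrite -(eqP az) inE zK adj_irrefl //.
have nK z : in_column a z -> z \notin K :\ a.
  by move=> az; rewrite !inE; apply/andP=> -[/eqP za /(notK _ az)].
have yn : y \notin K :\ a by apply: nK.
have xn : x \notin y |: K :\ a.
  by rewrite in_setU1 (negPf (adj_neq xy)) (negPf (nK _ ax)).
suff : clique (x |: (y |: K :\ a)).
  by move/K_max; rewrite !cardsU1 xn yn (cardsD1 a K) aK; lia.
have xK z : in_column a z -> {in K :\ a, forall b, z -- b}.
  by move=> az b /setD1P[ba bK]; rewrite adj_sym; apply: column_adj_root az _ _.
apply: clique_add; first apply: clique_add; last first.
- by move=> b /setU1P[->|/xK->].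
- exact: xK.
by apply/cliqueP=> u v /setD1P[_ uK] /setD1P[_ vK]; apply: (clique_adj K_clique).
Qed.

(** Vertices missing two given vertices of [K] are independent because there is no [2K_2],
    and every other vertex is in a column. *)
Lemma colourable_sqr : colourable G (#|K| ^ 2).
Proof.
have /fin_all_exists[p pP] v : exists ab : G * G,
    [/\ ab.1 \in missed v, ab.2 \in missed v & ab.1 = ab.2 -> in_column ab.1 v].
  have /set0Pn[a aM] := missed_neq0 v.
  have [M1|/subsetPn[b bM]] := boolP (missed v \subset [set a]).
    exists (a, a); split=> // _.
    by rewrite /in_column eqEsubset M1 sub1set.
  by rewrite inE => /eqP ba; exists (a, b); split=> //= ab; case: ba.
have -> : #|K| ^ 2 = #|setX K K| by rewrite cardsX.
apply: (@colourable_set _ _ _ p) => [v|v w vw].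
  by have [] := pP v; rewrite !inE => /andP[-> _] /andP[-> _].
apply/eqP=> pvw; have [av bv colv] := pP v; have [aw bw colw] := pP w.
rewrite pvw in av bv colv; have [ab|ab] := eqVneq (p w).1 (p w).2.
  by have := column_nadj (colv ab) (colw ab); rewrite vw.
move: av bv aw bw; rewrite !inE => /andP[aK av] /andP[bK bv] /andP[_ aw] /andP[_ bw].
have := no2K2 (clique_adj K_clique aK bK ab) vw.
by rewrite (negPf av) (negPf bv) (negPf aw) (negPf bw).
Qed.

Definition touched v := [set a in K | [exists x, in_column a x && x -- v]].
Definition free v := K :\: touched v.

Lemma free_sub v : free v \subset K. Proof. exact: subsetDl. Qed.

Lemma touched_sub v : touched v \subset K.
Proof. by apply/subsetP=> a; rewrite inE => /andP[]. Qed.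

Lemma free_nadj a x v : a \in free v -> in_column a x -> ~~ (x -- v).
Proof.
rewrite !inE => /andP[+ aK] ax; rewrite aK /=; apply: contra => xv.
by apply/existsP; exists x; rewrite ax.
Qed.

Lemma free_nadj_root a v : a \in free v -> ~~ (a -- v).
Proof.
move=> av; exact: free_nadj av (column_self (subsetP (free_sub v) _ av)).
Qed.

Lemma meet_free v w : v -- w -> #|free v :&: free w| <= 1.
Proof.
move=> vw; rewrite leqNgt; apply/negP=> /card_gt1P[a [b []]].
rewrite !in_setI => /andP[av aw] /andP[bv bw] ab.
have aK := subsetP (free_sub v) _ av; have bK := subsetP (free_sub v) _ bv.
have := no2K2 (clique_adj K_clique aK bK ab) vw.
rewrite (negPf (free_nadj_root av)) (negPf (free_nadj_root aw)).
by rewrite (negPf (free_nadj_root bv)) (negPf (free_nadj_root bw)).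
Qed.

Lemma untouched_columns v w : K :\: (free v :|: free w) = touched v :&: touched w.
Proof.
apply/setP=> a; have := subsetP (touched_sub v) a.
rewrite /free !in_setD in_setU !in_setD in_setI => h.
by case: (a \in touched v) h => [->|_] //; case: (a \in touched w);
   case: (a \in K).
Qed.

End Columns.

Section P4JoinFree.
Variables (G : sgraph) (K : {set G}) (n : nat).
Hypothesis no2K2 : forall a b c d : G,
  a -- b -> c -- d -> [|| a -- c, a -- d, b -- c | b -- d].
Hypothesis K_clique : clique K.
Hypothesis K_max : forall A : {set G}, clique A -> #|A| <= #|K|.
Hypothesis noP4K : ~ embeds ('P_4 ∨ 'K_n) G.
Hypothesis K_big : (3 * n + 8) ^ 2 <= #|K|.

Notation in_column := (in_column K).
Notation touched := (touched K).
Notation free := (free K).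

Lemma K_gt : n.+2 <= #|K|.
Proof. by apply: leq_trans K_big; rewrite -mulnn; nia. Qed.

(** Otherwise [x - b - a - y] is an induced path complete to the rest of [K]. *)
Lemma column_adj a b x y : in_column a x -> in_column b y -> a != b -> x -- y.
Proof.
move=> ax byy ab; apply: contraT => xy; case: noP4K.
have aK := column_mem ax; have bK := column_mem byy.
apply: (@embeds_P4_join _ x b a y (K :\: [set a; b])) => //.
- by rewrite adj_sym (column_adj_root ax) // eq_sym.
- by apply: (clique_adj K_clique) => //; rewrite eq_sym.
- exact: column_adj_root byy _ _.
- by rewrite adj_sym (column_nadj_root ax).
- exact: column_nadj_root byy.
- by apply/cliqueP=> u v /setDP[uK _] /setDP[vK _]; apply: (clique_adj K_clique).
- rewrite cardsDS ?cards2 ?ab; last by apply/subsetP=> u /set2P[]->.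
  by have := K_gt; lia.
move=> q; rewrite !inE negb_or => /andP[/andP[qa qb] qK].
apply/and4P; split.
- exact: column_adj_root ax qK qa.
- exact: (clique_adj K_clique qK bK qb).
- exact: (clique_adj K_clique qK aK qa).
- exact: column_adj_root byy qK qb.
Qed.

(** Distinct columns are complete to each other, so representatives of columns form a clique
    that can play the part of a subset of [K]. *)
Lemma representatives v (S : {set G}) : S \subset touched v ->
  exists Q : {set G}, [/\ clique Q, #|Q| = #|S|, {in Q, forall q, q -- v} &
    {in Q, forall q, exists2 a, a \in S & in_column a q}].
Proof.
move=> ST; pose r a := odflt a [pick x | in_column a x && x -- v].
have rP a : a \in S -> in_column a (r a) /\ r a -- v.
  move/(subsetP ST); rewrite inE => /andP[_ /existsP[x ax]]; rewrite /r.
  by case: pickP => [y /andP[]//|/(_ x)]; rewrite ax.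
have r_inj : {in S &, injective r}.
  move=> a b aS bS rab; have [ca _] := rP a aS; have [cb _] := rP b bS.
  by move: ca; rewrite rab /in_column (eqP cb) => /eqP/set1_inj->.
exists [set r a | a in S]; split.
- apply/cliqueP=> _ _ /imsetP[a aS ->] /imsetP[b bS ->] ne.
  have [ca _] := rP a aS; have [cb _] := rP b bS.
  by apply: column_adj ca cb _; apply: contraNneq ne => ->.
- exact: card_in_imset.
- by move=> _ /imsetP[a /rP[_ h] ->].
by move=> _ /imsetP[a aS ->]; exists a => //; have [] := rP a aS.
Qed.

(** Otherwise [v] and its neighbours in all columns form too large a clique. *)
Lemma free_columns_neq0 v : free v != set0.
Proof.
apply/negP; rewrite setD_eq0 => /representatives[Q [cQ szQ Qv _]].
have vQ : v \notin Q by apply/negP => /Qv; rewrite adj_irrefl.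
have : clique (v |: Q).
  by apply: clique_add => // x xQ; rewrite adj_sym Qv.
by move/K_max; rewrite cardsU1 vQ szQ ltnn.
Qed.

(** A vertex [v] with neighbours in many columns does not distinguish the vertices of a
    column. If [y] and [x] are a neighbour and a non-neighbour in the column of [a], and
    [d] is a column that [v] does not touch, then [v - y - d - x] is an induced path,
    complete to the neighbours of [v] in the other columns that it touches. *)
Lemma touched_pure v a x : n < #|touched v| -> a \in touched v ->
  in_column a x -> x -- v.
Proof.
move=> big aT ax; apply: contraT => xv; case: noP4K.
have : a \in touched v by []; rewrite inE => /andP[aK /existsP[y /andP[ay yv]]].
have /set0Pn[d dF] := free_columns_neq0 v.
have dK : d \in K by apply: (subsetP (free_sub K v)).
have da : d != a by apply: contraTneq dF => ->; rewrite inE aT.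
have dd := column_self K_clique dK.
have [|Q [cQ szQ Qv Qcol]] := @representatives v (touched v :\ a).
  exact: subsetDl.
apply: (@embeds_P4_join _ v y d x Q) => //.
- by rewrite adj_sym.
- by apply: column_adj ay dd _; rewrite eq_sym.
- exact: column_adj dd ax _.
- by rewrite adj_sym (free_nadj_root K_clique dF).
- by rewrite adj_sym.
- exact: column_nadj ay ax.
- by rewrite szQ; move: big; rewrite (cardsD1 a) aT ltnS.
move=> q qQ; rewrite Qv //=; have [b /setD1P[ba bT] bq] := Qcol q qQ.
rewrite (column_adj bq ay) // (column_adj bq ax) // andbT /=.
by apply: column_adj bq dd _; apply: contraTneq bT => ->; case/setDP: dF.
Qed.

Lemma touched_root v a : n < #|touched v| -> a \in touched v -> a -- v.
Proof.
move=> big aT; apply: (touched_pure big aT); apply: column_self => //.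
exact: (subsetP (touched_sub K v)).
Qed.

Lemma card_free v : #|free v| = #|K| - #|touched v|.
Proof. by rewrite cardsDS // touched_sub. Qed.

(** A vertex with one free colour touches all other columns, so it is complete to them
    and belongs to the remaining column. *)
Lemma single_free_column v : #|free v| <= 1 -> exists a, in_column a v.
Proof.
move=> F1; have /set0Pn[a aM] := missed_neq0 K_clique K_max v.
have big : n < #|touched v|.
  have := subset_leq_card (touched_sub K v); have := K_gt.
  by move: F1; rewrite card_free; lia.
have MF : missed K v \subset free v.
  apply/subsetP=> b; rewrite !inE => /andP[bK bv]; rewrite bK andbT.
  apply: contra bv => /andP[_ ex]; apply: touched_root => //.
  by rewrite inE bK.
exists a; rewrite /in_column eq_sym eqEcard sub1set aM cards1.
exact: leq_trans (subset_leq_card MF) F1.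
Qed.

(** With a common free colour [a] and a colour [b] free for [w] only, [a - b - v - w] is
    an induced path, complete to the columns that [v] and [w] both touch. *)
Lemma free_cover v w : v -- w -> 1 < #|free w| -> free v :&: free w != set0 ->
  #|K :\: (free v :|: free w)| <= n.
Proof.
move=> vw Fw /set0Pn[a]; rewrite inE => /andP[av aw].
rewrite untouched_columns leqNgt; apply/negP=> big; case: noP4K.
have bigv := leq_trans big (subset_leq_card (subsetIl _ _)).
have bigw := leq_trans big (subset_leq_card (subsetIr _ _)).
have [b bw bv] : exists2 b, b \in free w & b \notin free v.
  have /subsetPn[b] : ~~ (free w \subset free v); last by exists b.
  apply/negP=> /setIidPr sub; have := meet_free no2K2 K_clique vw.
  by rewrite sub leqNgt Fw.
have aK := subsetP (free_sub K v) _ av; have bK := subsetP (free_sub K w) _ bw.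
have bT : b \in touched v by move: bv; rewrite inE bK andbT negbK.
have KP x y := @clique_adj G K x y K_clique.
apply: (@embeds_P4_join _ a b v w (touched v :&: touched w)) => //.
- by apply: KP => //; apply: contraNneq bv => <-.
- exact: touched_root.
- exact: free_nadj_root av.
- exact: free_nadj_root aw.
- exact: free_nadj_root bw.
- apply/cliqueP=> x y /setIP[xT _] /setIP[yT _]; apply: KP.
    exact: (subsetP (touched_sub K v)).
  exact: (subsetP (touched_sub K v)).
- exact: ltnW.
move=> q /setIP[qv qw]; have qK := subsetP (touched_sub K v) _ qv.
apply/and4P; split; try exact: touched_root.
  by apply: KP => //; apply: contraTneq qv => ->; case/setDP: av.
by apply: KP => //; apply: contraTneq qw => ->; case/setDP: bw.
Qed.

(** With [a] free for [v] only and [b] free for [w] only, [v - b - a - w] is an induced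
    path, complete to the columns that [v] and [w] both touch. *)
Lemma free_nested v w : ~~ (v -- w) ->
  [\/ free v \subset free w, free w \subset free v
    | #|K :\: (free v :|: free w)| <= n].
Proof.
move=> vw; have [|/subsetPn[a av aw]] := boolP (free v \subset free w).
  by constructor 1.
have [|/subsetPn[b bw bv]] := boolP (free w \subset free v).
  by constructor 2.
constructor 3; rewrite untouched_columns leqNgt; apply/negP=> big; case: noP4K.
have bigv := leq_trans big (subset_leq_card (subsetIl _ _)).
have bigw := leq_trans big (subset_leq_card (subsetIr _ _)).
have aK := subsetP (free_sub K v) _ av; have bK := subsetP (free_sub K w) _ bw.
have bT : b \in touched v by move: bv; rewrite inE bK andbT negbK.
have aT : a \in touched w by move: aw; rewrite inE aK andbT negbK.
have KP x y := @clique_adj G K x y K_clique.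
apply: (@embeds_P4_join _ v b a w (touched v :&: touched w)) => //.
- by rewrite adj_sym touched_root.
- by apply: KP => //; apply: contraNneq bv => ->.
- exact: touched_root.
- by rewrite adj_sym (free_nadj_root K_clique av).
- exact: free_nadj_root bw.
- apply/cliqueP=> x y /setIP[xT _] /setIP[yT _]; apply: KP.
    exact: (subsetP (touched_sub K v)).
  exact: (subsetP (touched_sub K v)).
- exact: ltnW.
move=> q /setIP[qv qw]; have qK := subsetP (touched_sub K v) _ qv.
apply/and4P; split; try exact: touched_root.
  by apply: KP => //; apply: contraTneq qw => ->; case/setDP: bw.
by apply: KP => //; apply: contraTneq qv => ->; case/setDP: av.
Qed.

(** Vertices with one free colour are in the columns and take that colour, which is free for
    none of their neighbours. For all others the lists of free colours satisfy the
    hypotheses of [conflict_free_choice]. *)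
Lemma colourable_clique : colourable G #|K|.
Proof.
pose V := {v : G | 1 < #|free v|}.
have [||||||c cP] := @conflict_free_choice V G (fun v w => val v -- val w) K
  (fun v => free (val v)) n _ _ _ _ _ _ K_big.
- by move=> v w; apply: adj_sym.
- by move=> v; apply: free_sub.
- by move=> v; apply: (valP v).
- by move=> v w; apply: meet_free.
- by move=> v w vw; apply: free_cover vw (valP w).
- by move=> v w; apply: free_nested.
have /fin_all_exists[f fP] v : exists a, (a \in free v) /\
    forall u : V, val u = v -> a = c u.
  have [gt1|le1] := boolP (1 < #|free v|).
    exists (c (Sub v gt1)); split.
      by have [] := cP (Sub v gt1) (Sub v gt1).
    by move=> u uv; congr c; apply: val_inj; rewrite uv.
  have /set0Pn[a av] := free_columns_neq0 v; exists a; split=> // u uv.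
  by case/negP: le1; rewrite -uv; apply: (valP u).
have fF v : f v \in free v by case: (fP v).
apply: (@colourable_set _ _ _ f) => [v|v w vw].
  exact: (subsetP (free_sub K v)).
have single u z : u -- z -> #|free u| <= 1 -> f u != f z.
  move=> uz /single_free_column[a au]; apply: contraTneq (fF z) => <-.
  have -> : f u = a.
    apply/eqP; rewrite -in_set1 -(eqP au) inE.
    by rewrite (subsetP (free_sub K u) _ (fF u)) (free_nadj_root K_clique (fF u)).
  apply/negP=> az; have := free_nadj az au; by rewrite uz.
have [v1|v1] := leqP #|free v| 1; first exact: single.
have [w1|w1] := leqP #|free w| 1.
  by rewrite eq_sym; apply: single; rewrite 1?adj_sym.
have [_ fv] := fP v; have [_ fw] := fP w.
rewrite (fv (Sub v v1)) // (fw (Sub w w1)) //.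
by have [_] := cP (Sub v v1) (Sub w w1); apply.
Qed.

End P4JoinFree.

Theorem chi_2K2_P4_join_free (G : sgraph) n :
  ~ embeds (copies 'K_2 2) G -> ~ embeds ('P_4 ∨ 'K_n) G ->
  chi G <= maxn ((3 * n + 8) ^ 4) (omega G).
Proof.
move=> no2 noP; have [K cK szK] := max_clique G.
have K_max (A : {set G}) : clique A -> #|A| <= #|K|.
  by rewrite szK; apply: clique_omega.
have no2K2 (a b c d : G) : a -- b -> c -- d -> [|| a -- c, a -- d, b -- c | b -- d].
  move=> ab cd; apply: contraT; rewrite !negb_or => /and4P[ac ad bc bd].
  by case: no2; apply: embeds_2K2 ab cd ac ad bc bd.
rewrite leq_max !chi_leq; have [big|small] := leqP ((3 * n + 8) ^ 2) #|K|.
  by rewrite -szK (colourable_clique no2K2 cK K_max noP big) orbT.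
apply/orP; left; rewrite -chi_leq.
apply: (@leq_trans (#|K| ^ 2)).
  by rewrite chi_leq colourable_sqr.
by rewrite (_ : 4 = 2 * 2) // expnM leq_sqr ltnW.
Qed.

(** * The characterization *)

Lemma not_free2 (H1 H2 G : sgraph) : ~ free2 H1 H2 G -> embeds H1 G \/ embeds H2 G.
Proof.
move=> nf; have [e1|n1] := embedsP H1 G; first by left.
have [e2|n2] := embedsP H2 G; first by right.
by case: nf; split=> /containsP.
Qed.

Lemma forest_or_cycle (G : sgraph) :
  forest G \/ exists2 s : seq G, ucycle (@adj G) s & 2 < size s <= #|G|.
Proof.
have [/existsP[k /existsP[s /andP[us ks]]]|none] := boolP [exists k : 'I_#|G|.+1,
    [exists s : k.-tuple G, (cycle (@adj G) s && uniq s) && (2 < k)]].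
  right; exists s => //; rewrite size_tuple ks; exact: (ltn_ord k).
left=> s us; rewrite ltnNge; apply: contra none => gt2; have /andP[_ un] := us.
have sz : size s < #|G|.+1 by rewrite ltnS -(card_uniqP un) max_card.
apply/existsP; exists (Ordinal sz); apply/existsP; exists (in_tuple s).
by rewrite gt2 andbT.
Qed.

(** A graph whose girth exceeds the length of some cycle in each of [H1] and [H2] contains
    neither of them. *)
Lemma forest_of_bound (H1 H2 : sgraph) :
  near_optimal_colourable (free2 H1 H2) -> forest H1 \/ forest H2.
Proof.
move=> [c bound].
have [|[s1 u1 /andP[l1 b1]]] := forest_or_cycle H1; first by left.
have [|[s2 u2 /andP[l2 b2]]] := forest_or_cycle H2; first by right.
have [G [girth nc]] := large_girth_large_chi (#|H1| + #|H2|) (maxn c 2).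
have noE (H : sgraph) (s : seq H) : ucycle (@adj H) s -> 2 < size s ->
    size s <= #|H1| + #|H2| -> ~ embeds H G.
  move=> /andP[cs us] gt2 le [f fI fM].
  have := girth (map f s); rewrite size_map ltnNge gt2 => h.
  suff : false by [].
  apply: h => //; apply/andP; split; last by rewrite map_inj_uniq.
  by rewrite cycle_map (eq_cycle fM).
case: (negP nc); rewrite -chi_leq; apply: leq_trans (bound G _) _.
  by split=> /containsP; [apply: noE u1 l1 _|apply: noE u2 l2 _]; lia.
rewrite geq_max leq_maxl leq_max; apply/orP; right.
apply: omega_leq => A cA; rewrite leqNgt; apply/negP.
case/card_gt2P=> x [y [z [[xA yA zA] [xy yz zx]]]].
have := girth [:: x; y; z]; rewrite /ucycle /= !inE negb_or xy yz [x == z]eq_sym zx.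
rewrite (clique_adj cA xA yA xy) (clique_adj cA yA zA yz) (clique_adj cA zA xA zx) /=.
move=> /(_ isT) g3; suff : false by [].
exact: g3 (leq_trans l1 (leq_trans b1 (leq_addr _ _))).
Qed.

(** The forest [H1] has three pairwise non-adjacent vertices or is [2K_2], so it is
    contained in no join of [K_c] with [C_5] or with the complement of [C_7]; both must
    contain [H2]. A copy of [H2] in the first join that used all of [C_5] would put [C_5]
    into the complement of [C_7]. So it misses a vertex of [C_5] and lies in
    [P_4 ∨ K_c]. *)
Lemma classX_of_bound (H1 H2 : sgraph) :
    near_optimal_colourable (free2 H1 H2) -> forest H1 ->
    ~ embeds H1 'P_4 -> ~ embeds H2 'P_4 ->
  classX H2.
Proof.
move=> [c bound] forest1 H1_P4 H2_P4.
have only2 (G : sgraph) k : no_triple G -> ~ embeds (copies 'K_2 2) G ->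
    omega G <= k -> ~~ colourable G k -> embeds H2 (G ∨ 'K_c).
  move=> ntG no2 om nc; have nf := join_escapes_bound bound om nc.
  have [e1|//] := not_free2 nf; case: no2.
  have nt1 := no_triple_embeds e1 (no_triple_join ntG).
  have iso1 := no_triple_forest_2K2 forest1 nt1 H1_P4.
  apply: (@embeds_join_nodom _ _ c); last first.
    by apply: embeds_trans e1; apply/iso_embeds/iso_sym.
  move=> [i j]; exists (if i == ord0 then ord_max else ord0, j).
    by case: (ord2_cases i) => ->.
  by rewrite /= /copies_adj /=; case: (ord2_cases i) => ->.
have [f fI fM] := only2 _ _ no_triple_C5 no_2K2_C5 omega_C5 C5_not_colourable.
have e7 := only2 _ _ no_triple_coC7 no_2K2_coC7 omega_coC7 coC7_not_colourable.
have [surj|] := boolP [forall i : 'I_5, [exists x, f x == inl i]].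
  have /fin_all_exists[pre preP] (i : 'I_5) : exists x, f x = inl i.
    by have /existsP[x /eqP] := forallP surj i; exists x.
  case: no_C5_coC7; apply: (@embeds_join_nodom _ _ c).
    move=> i; exists (inord ((i + 2) %% 5)).
      by case: i => [[|[|[|[|[|]]]]] ] //= lt; rewrite -val_eqE /= inordK.
    by case: i => [[|[|[|[|[|]]]]] ] //= lt; rewrite /cycle_adj inordK.
  apply: embeds_trans e7; exists pre => [i j e|i j].
    by have := preP i; rewrite e preP => -[].
  by rewrite -fM !preP.
rewrite negb_forall => /existsP[m]; rewrite negb_exists => /forallP miss.
apply: (@P4_join_classX _ c) => //.
(* Rotate so that the missing vertex [m] becomes 4. *)
pose g (i : 'I_5) : 'P_4 := inord ((i + (4 - m)) %% 5).
pose h (u : cycleG 5 ∨ 'K_c) : 'P_4 ∨ 'K_c :=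
  match u with inl i => inl (g i) | inr k => inr k end.
have chk : all_lt 5 (fun m => all_lt 5 (fun i => (i != m) ==>
    ((i + (4 - m)) %% 5 < 4) && all_lt 5 (fun j => (j != m) ==>
      ((((i + (4 - m)) %% 5 == (j + (4 - m)) %% 5) == (i == j)) &&
       ((((i + (4 - m)) %% 5).+1 == (j + (4 - m)) %% 5) ||
        (((j + (4 - m)) %% 5).+1 == (i + (4 - m)) %% 5) == cyc 5 i j))))).
  by vm_compute.
have lt4 (i : 'I_5) : i != m -> (i + (4 - m)) %% 5 < 4.
  by move=> im; have /implyP/(_ im)/andP[] := all_ltP (all_ltP chk m) i.
have gP (i j : 'I_5) : i != m -> j != m ->
    (g i == g j) = (i == j) /\ path_adj (g i) (g j) = cyc 5 i j.
  move=> im jm; have /implyP/(_ im)/andP[_ ci] := all_ltP (all_ltP chk m) i.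
  have /implyP/(_ jm)/andP[/eqP e1 /eqP e2] := all_ltP ci j.
  by rewrite -val_eqE /= /path_adj /g !inordK ?lt4.
have fm x i : f x = inl i -> i != m.
  by move=> fx; apply: contraNneq (miss x) => <-; apply/eqP.
exists (fun x => h (f x)) => [x y|x y].
  rewrite /h; case fx: (f x) => [i|k]; case fy: (f y) => [j|l] // [e].
    have [/esym ij _] := gP _ _ (fm _ _ fx) (fm _ _ fy).
    by apply: fI; rewrite fx fy; congr inl; apply/eqP; rewrite ij e.
  by apply: fI; rewrite fx fy e.
rewrite -fM /h; case fx: (f x) => [i|k]; case fy: (f y) => [j|l] //=.
by have [_ ->] := gP _ _ (fm _ _ fx) (fm _ _ fy).
Qed.

Lemma classX'_not_forest (H : sgraph) : classX' H -> ~ forest H.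
Proof.
move=> X' fH.
suff [x [y [z [xy yz xz]]]] : exists x y z : H, [/\ x -- y, y -- z & x -- z].
  have := fH [:: x; y; z]; rewrite /ucycle /= xy yz adj_sym xz /=.
  by rewrite !inE negb_or !adj_neq // => /(_ isT).
have tri (G : sgraph) (x y z : G) : H ≃ G -> x -- y -> y -- z -> x -- z ->
    exists x y z : H, [/\ x -- y, y -- z & x -- z].
  move=> /iso_sym[f _ fM] xy yz xz; exists (f x), (f y), (f z).
  by rewrite !fM.
case: X' => -[n n1 isoH].
  pose p i : 'P_4 ∨ 'K_n := inl (inord i).
  by apply: (tri _ (p 0) (p 1) (inr (Ordinal n1)) isoH); rewrite //= /path_adj !inordK.
pose p i : ('K_2 ⊕ 'K_1) ∨ 'K_n := inl (inl i).
exact: (tri _ (p ord0) (p ord_max) (inr (Ordinal (ltnW n1))) isoH).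
Qed.

Lemma classX'_not_blowup (H : sgraph) s : classX' H -> ~ embeds H (blowup s).
Proof.
case=> -[n n1 isoH] e.
  apply: (@no_P4_join_blowup s n n1); apply: embeds_trans e.
  exact/iso_embeds/iso_sym.
apply: (@no_K2K1_join_blowup s n n1); apply: embeds_trans e.
exact/iso_embeds/iso_sym.
Qed.

Lemma classX'_P4_join (H : sgraph) : classX' H -> exists n, embeds H ('P_4 ∨ 'K_n).
Proof.
case=> -[n _ isoH]; exists n; apply: embeds_trans (iso_embeds isoH) _.
  by exists id.
exists (@join_map _ _ n K2K1_in_P4).
  exact: join_map_inj K2K1_in_P4_inj.
exact: join_map_mono K2K1_in_P4_mono.
Qed.

(** The clique blow-up violates the bound and contains no graph in [classX'], so it
    contains [H1]. *)
Lemma no_triple_of_bound (H1 H2 : sgraph) :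
    near_optimal_colourable (free2 H1 H2) -> classX' H2 -> no_triple H1.
Proof.
move=> [c bound] X'.
have nf : ~ free2 H1 H2 (blowup c).
  move=> /bound; have om := omega_blowup c; have /negP nc := blowup_not_colourable c.
  rewrite leqNgt => /negP[]; rewrite ltnNge -chi_leq in nc *.
  apply/negP=> le; apply: nc; lia.
have [e1|e2] := not_free2 nf; first exact: no_triple_embeds e1 (@no_triple_blowup c).
by case: (classX'_not_blowup X' e2).
Qed.

Lemma near_optimal_swap (H1 H2 : sgraph) :
  near_optimal_colourable (free2 H1 H2) -> near_optimal_colourable (free2 H2 H1).
Proof. by move=> [c bound]; exists c => G [n2 n1]; apply: bound. Qed.

Theorem theorem2 (H1 H2 : sgraph)
  (H1_P4 : ~ contains 'P_4 H1) (H2_P4 : ~ contains 'P_4 H2) :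
  (near_optimal_colourable (free2 H1 H2) ->
     (forest H1 /\ classX H2) \/ (forest H2 /\ classX H1)) /\
  (classX' H2 ->
     (near_optimal_colourable (free2 H1 H2) <-> H1 ≃ copies 'K_2 2)).
Proof.
have nE1 : ~ embeds H1 'P_4 by move/containsP.
have nE2 : ~ embeds H2 'P_4 by move/containsP.
split=> [no|X'].
  have [f1|f2] := forest_of_bound no; [left|right]; split=> //.
    exact: classX_of_bound no f1 nE1 nE2.
  exact: classX_of_bound (near_optimal_swap no) f2 nE2 nE1.
split=> [no|iso1].
  have [f1|/(classX'_not_forest X')//] := forest_of_bound no.
  exact: no_triple_forest_2K2 f1 (no_triple_of_bound no X') nE1.
have [n H2n] := classX'_P4_join X'.
exists ((3 * n + 8) ^ 4) => G [nc1 nc2].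
apply: chi_2K2_P4_join_free => [e|e].
  by apply/nc1/containsP; apply: embeds_trans (iso_embeds iso1) e.
by apply/nc2/containsP; apply: embeds_trans H2n e.
Qed.
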